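(* Let $k>1$ and consider dynamic cactus graphs $\mathcal{G}$ on $n$ nodes with at most $k$ dynamic edges at any round, with a whiteboard at every node. Any algorithm that solves the black hole search problem on all such graphs with $k+2$ agents, which have distinct Ids and are initially co-located, requires, in the worst case, $\Omega\big((n+2-3k)^{1.5}\big)$ rounds and $\Omega\big((n+2-3k)^{1.5}+2k\big)$ moves.
   Context: Cactus graph: a connected undirected graph in which any two distinct simple cycles share at most one vertex (equivalently, every edge lies on at most one simple cycle). Dynamic cactus graph with at most $k$ dynamic edges at any round: a fixed cactus (the footprint, $G_0$) on a static vertex set $V$ with $|V|=n$, together with a sequence of graphs $G_0,G_1,G_2,\dots$, $G_r=(V,E_r)$, where $G_r$ is the footprint with at most $k$ edges missing, and each $G_r$ is connected ($1$-interval connectivity). At each round an adversary chooses which edges are missing; missing edges may reappear later. The degree $\deg(v)$ is the degree in $G_0$; $\Delta$ is the maximum degree. Nodes are anonymous. At each node $v$ the incident edges carry distinct port numbers $0,\dots,\deg(v)-1$ (in counter-clockwise order); the two port numbers of an edge are unrelated. Each node $v$ has a whiteboard of $O(\deg(v)(\log\deg(v)+k\log k))$ bits, readable and writable by visiting agents under fair mutual exclusion. Black hole: one node of the graph is a black hole; every agent entering it is destroyed without a trace. Agents: a set of $m\le n$ agents with distinct Ids in $[1,m]$, initially co-located at a node called home that is known not to be the black hole. All agents execute the same deterministic algorithm; each has $O(n\log\Delta)$ bits of memory. An agent at a node sees the degree, which incident edges are currently missing, the whiteboard, and the Ids of the other agents there, and can communicate with these agents. When moving along an edge it knows the port by which it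 leaves and the port by which it arrives. Any number of agents may use an edge simultaneously. Rounds: in every synchronous round each agent communicates (with co-located agents and via the whiteboard), computes a decision to stay or to leave through a port, and then moves (traversing a present edge takes one round). The number of moves is the total number of edge traversals made by all agents. Black hole search problem (BHS): within finitely many rounds, at least one agent must survive, know the location of the black hole, and terminate, whatever the footprint, its port numbering, the location of the black hole, and the adversary's choice of missing edges. Here $m=k+2$. Worst case means the maximum over all instances with $n$ nodes and all adversary strategies; $\Omega(\cdot)$ is understood with constants independent of $n$ and $k$, for $n+2-3k$ positive and sufficiently large. *)

(* Defs.v *)
(* MathComp, with MathComp-Analysis for real powers in the statement *)
From HB Require Import structures.
From mathcomp Require Import all_boot.

Set Implicit Arguments.
Unset Strict Implicit.
Unset Printing Implicit Defensive.

Section Graphs.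
Variable V : finType.
Implicit Types (e : rel V) (v : V) (c : seq V).

Definition connected_graph e : Prop := forall u v, connect e u v.

Definition simple_cycle e c : bool := ucycleb e c && (2 < size c).

Definition cycle_edges c : {set {set V}} :=
  [set [set x; next c x] | x in [set y in c]].

(* The sequence [c] carries a base point and a direction; two sequences
   describe the same cycle of the graph iff their edge sets are equal. *)
Definition cactus e : Prop :=
  connected_graph e /\
  forall c1 c2, simple_cycle e c1 -> simple_cycle e c2 ->
    cycle_edges c1 != cycle_edges c2 ->
    #|[set x in c1] :&: [set x in c2]| <= 1.

Definition deg e v : nat := #|[set u | e v u]|.

Definition max_deg e : nat := \max_v deg e v.

Definition edges e : {set {set V}} :=
  [set [set p.1; p.2] | p in [set p : V * V | e p.1 p.2]].

Definition remove_edges e (S : {set {set V}}) : rel V :=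
  [rel u v | e u v && ([set u; v] \notin S)].

(* The ports at every node increase counter-clockwise in a plane drawing.  In
   a plane drawing of a cactus two cycles through a common node do not cross
   there, i.e. the ports of one do not separate those of the other, and every
   numbering with this property comes from a drawing.  As each cycle occurs in
   both directions, one order of the four ports is enough; cycles with the
   same edges satisfy the condition vacuously. *)
Definition counter_clockwise e (port : V -> V -> nat) : Prop :=
  forall c1 c2 v, simple_cycle e c1 -> simple_cycle e c2 ->
    v \in c1 -> v \in c2 ->
    ~~ [&& port v (next c1 v) < port v (next c2 v),
           port v (next c2 v) < port v (prev c1 v) &
           port v (prev c1 v) < port v (prev c2 v)].

End Graphs.

(* [port u v] is the port number at [u] of the edge uv (irrelevant when [u] and
   [v] are not adjacent); [absent r] is the set of edges missing from G_r.
   The adversary is a fixed sequence [absent]: against deterministic agents an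
   adaptive adversary is no more powerful. *)
Record dynamic_cactus (n k : nat) := DynamicCactus {
  adj : rel 'I_n;
  adj_sym : symmetric adj;
  adj_irrefl : irreflexive adj;
  adj_cactus : cactus adj;
  port : 'I_n -> 'I_n -> nat;
  port_lt : forall u v, adj u v -> port u v < deg adj u;
  port_inj : forall u v w, adj u v -> adj u w -> port u v = port u w -> v = w;
  port_ccw : counter_clockwise adj port;
  absent : nat -> {set {set 'I_n}};
  absent0 : absent 0 = set0;
  absent_sub : forall r, absent r \subset edges adj;
  absent_card : forall r, #|absent r| <= k;
  absent_connected : forall r, connected_graph (remove_edges adj (absent r))
}.

Record instance (n k : nat) := Instance {
  dyn :> dynamic_cactus n k;
  home : 'I_n;
  black_hole : 'I_n;
  home_safe : home != black_hole
}.

Definition bits := seq bool.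

(* What is shown of an agent to the agents at the same node.  [ag_arrival] is
   [Some p] if the agent arrived through port [p] in the previous round, and
   [None] if it did not move. *)
Record presence := Presence {
  ag_id : nat;
  ag_memory : bits;
  ag_arrival : option nat
}.

Record view := View {
  view_deg : nat;
  view_missing : seq nat;
  view_board : bits;
  view_agents : seq presence
}.

(* [Terminate (Some w)] declares that the black hole is at the end of the walk
   that starts at the agent's current node and leaves through the successive
   ports [w]; [Terminate None] stops without declaring anything. *)
Inductive action :=
  | Stay
  | Move of nat
  | Terminate of option (seq nat).

(* The agents at a node exchange everything they know and access the whiteboard
   in mutual exclusion before anyone moves, so the outcome of a round at a
   node is a function of the view: [decide A w i] is the new memory and the
   decision of the agent with Id [i], and [write A w] is the content left on the
   whiteboard. *)
Record algorithm := Algorithm {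
  decide : view -> nat -> bits * action;
  write : view -> bits
}.

Inductive status :=
  | Active
  | Terminated of option (seq nat)
  | Destroyed.

Record agent (n : nat) := Agent {
  position : 'I_n;
  memory : bits;
  arrival : option nat;
  state : status
}.

(* Agent number [i] has Id [i.+1]; [moves] counts the edge traversals so far. *)
Record config (n m : nat) := Config {
  agents : 'I_m -> agent n;
  board : 'I_n -> bits;
  moves : nat
}.

Definition is_active n (a : agent n) : bool :=
  if state a is Active then true else false.

Definition is_destroyed n (a : agent n) : bool :=
  if state a is Destroyed then true else false.

Section Execution.
Variables (n k : nat) (A : algorithm) (I : instance n k).
Implicit Types (v : 'I_n) (r : nat).

Definition neighbor v (p : nat) : option 'I_n :=
  [pick u | adj I v u && (port I v u == p)].

Definition is_missing r v (p : nat) : bool :=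
  if neighbor v p is Some u then [set v; u] \in absent I r else false.

Fixpoint walk v (w : seq nat) : option 'I_n :=
  if w is p :: w' then
    if neighbor v p is Some u then walk u w' else None
  else Some v.

(* The node reached in round [r] from [v] through port [p], if the port exists
   and its edge is present. *)
Definition target r v (p : nat) : option 'I_n :=
  if is_missing r v p then None else neighbor v p.

Section Round.
Variables (m r : nat) (s : config n m).

Definition view_at v : view :=
  View (deg (adj I) v)
       [seq p <- iota 0 (deg (adj I) v) | is_missing r v p]
       (board s v)
       [seq Presence i.+1 (memory (agents s i)) (arrival (agents s i)) |
         i : 'I_m <- enum 'I_m &
         ~~ is_destroyed (agents s i) && (position (agents s i) == v)].

Definition decision (i : 'I_m) : bits * action :=
  decide A (view_at (position (agents s i))) i.+1.

(* The node entered by agent [i] in this round, if it traverses an edge; an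
   agent that tries to leave through an unavailable port stays. *)
Definition destination (i : 'I_m) : option 'I_n :=
  if is_active (agents s i) then
    if (decision i).2 is Move p then target r (position (agents s i)) p
    else None
  else None.

Definition next_agent (i : 'I_m) : agent n :=
  let a := agents s i in
  if is_active a then
    let: (mem, act) := decision i in
    if act is Terminate claim then
      Agent (position a) mem None (Terminated claim)
    else if destination i is Some u then
      Agent u mem (Some (port I u (position a)))
            (if u == black_hole I then Destroyed else Active)
    else Agent (position a) mem None Active
  else Agent (position a) (memory a) None (state a).

Definition next_board v : bits :=
  if [exists i, is_active (agents s i) && (position (agents s i) == v)]
  then write A (view_at v) else board s v.

Definition next_config : config n m :=
  Config next_agent next_board (moves s + #|[set i | destination i]|).

End Round.

Definition initial_config : config n (k + 2) :=
  Config (fun=> Agent (home I) [::] None Active) (fun=> [::]) 0.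

(* The configuration after rounds 0, ..., T - 1, round r taking place in G_r. *)
Fixpoint run (T : nat) : config n (k + 2) :=
  if T is r.+1 then next_config r (run r) else initial_config.

Definition solved_by (T : nat) : Prop :=
  exists i w, state (agents (run T) i) = Terminated (Some w) /\
    walk (position (agents (run T) i)) w = Some (black_hole I).

(* Declaring is knowing, not guessing: no agent ever declares a wrong node. *)
Definition never_wrong : Prop :=
  forall T i w, state (agents (run T) i) = Terminated (Some w) ->
    walk (position (agents (run T) i)) w = Some (black_hole I).

End Execution.

Definition solves_BHS (n k : nat) (A : algorithm) : Prop :=
  forall I : instance n k, never_wrong A I /\ exists T, solved_by A I T.

(* [up_log 2] is the binary logarithm rounded up. *)
Definition memory_bounded (Ca Cb n k : nat) (A : algorithm) : Prop :=
  forall (I : instance n k) (T : nat),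
    (forall i, size (memory (agents (run A I T) i))
       <= Ca * (n * up_log 2 (max_deg (adj I)))) /\
    (forall v, size (board (run A I T) v)
       <= Cb * (deg (adj I) v *
                (up_log 2 (deg (adj I) v) + k * up_log 2 k))).

(* Main.v *)
From Stdlib Require Import Classical_Prop.
Require Import Defs.
From mathcomp Require Import all_boot all_order all_algebra.
From mathcomp Require Import reals exp.
From mathcomp Require Import zify ring lra.

(** The footprint is a chain of [k-1] triangles, the gates, that leads from the
    home node to a long ring.  Every gate permanently misses one of its edges,
    chosen so that at least one more agent remains behind each gate; hence at most
    three agents ever take part in the search of the ring, where one further edge
    may be missing.

    In the ring the adversary plays an egg-drop game with two eggs.  Put
    [W = w^2], with the ring longer than [6W].  As long as at least two agents are in
    one half of the ring, the foremost of them is blocked; so whoever enters an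
    unvisited node is alone in its half, and news of its progress has to travel a
    distance of order [W].  Either every [w] new nodes cost [W] ring moves, which
    gives [w W] in all, or some agent [a] visits [w] nodes [cand 1], ..., [cand w]
    so quickly that nobody else can know.  In that case let [a] die at any of them.
    The adversary then keeps the two other agents out of that side, so they must
    examine the candidates from the far end.  If an agent [o] examines two candidates
    at a cost less than [W], the adversary lets [o] die at either of them; the only
    agent left in the ring has not heard of the first visit, and one missing edge
    suffices to keep it for ever away from all places where the two worlds differ.
    So [w - 2] candidates cost [W] each.  The bound [w^2 (w - 2)] is of order
    [(n+2-3k)^1.5], and an agent has to cross all gates, which takes [k] moves. *)

Set Implicit Arguments.
Unset Strict Implicit.
Unset Printing Implicit Defensive.

(** * The footprint *)

Lemma next_neq_prev (T : eqType) (c : seq T) (x : T) :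
  uniq c -> 2 < size c -> x \in c -> next c x != prev c x.
Proof.
move=> Uc sz xc; apply/eqP => E.
have E2 : next c (next c x) = x by rewrite E next_prev.
have [i s Ec] := rot_to xc.
have Ur : uniq (x :: s) by rewrite -Ec rot_uniq.
have sz' : 2 < size (x :: s) by rewrite -Ec size_rot.
have N y : next (x :: s) y = next c y by rewrite -Ec next_rot.
move: E2; rewrite -!N; case: s Ur sz' {Ec N} => [|y [|z s]] //= Ur _.
rewrite eqxx; case: eqP Ur => [->|_]; first by rewrite inE eqxx.
by rewrite eqxx => Ur ezx; move: Ur; rewrite ezx !inE eqxx !orbT.
Qed.

Section Footprint.
Variables n' K : nat.
Hypothesis Kn : K.*2 + 3 <= n'.
Local Notation V := 'I_n'.+1.
Local Notation root := K.*2.+1.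

(* The nodes form a path 0, 1, ..., n'.  For [i < K] the chord from [2i+1] to [2i+3]
   closes a triangle; the chord from [root] to [n'] closes the ring. *)
Definition chord (a b : nat) : bool :=
  (odd a && (b == a.+2) && (b <= root)) || ((a == root) && (b == n')).

Definition forward (a b : nat) : bool := (b == a.+1) || chord a b.

Definition fadj : rel V := [rel u v : V | forward u v || forward v u].

Lemma fadjP (u v : V) : reflect (forward u v \/ forward v u) (fadj u v).
Proof. exact: orP. Qed.

Lemma forward_lt a b : forward a b -> a < b.
Proof. by rewrite /forward /chord; lia. Qed.

Lemma chord_lt a b : chord a b -> a.+1 < b.
Proof. by rewrite /chord; lia. Qed.

(** Two chords overlap at most in an end, so no second chord fits between [lo] and [b]. *)
Lemma block_forward lo b x y : chord lo b -> lo <= x -> y <= b -> forward x y ->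
  y = x.+1 \/ x = lo /\ y = b.
Proof.
rewrite /forward => Clb lox yb /orP[/eqP|Cxy]; first by left.
by right; move: Clb Cxy; rewrite /chord; lia.
Qed.

Lemma fadj_sym : symmetric fadj.
Proof. by move=> u v; rewrite /fadj /= orbC. Qed.

Lemma fadj_irrefl : irreflexive fadj.
Proof.
move=> u; apply/negbTE/negP => /orP[]/forward_lt; by rewrite ltnn.
Qed.

(** * Cycles of the footprint *)

Section Cycle.
Variable c : seq V.
Hypothesis Cc : simple_cycle fadj c.

Lemma cycle_uniq : uniq c.
Proof. by case/andP: Cc => /andP[]. Qed.

Lemma cycle_next x : x \in c -> fadj x (next c x).
Proof. by case/andP: Cc => /andP[/next_cycle H _] _ /H. Qed.

Lemma cycle_prev x : x \in c -> fadj x (prev c x).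
Proof. by rewrite fadj_sym; case/andP: Cc => /andP[/prev_cycle H _] _ /H. Qed.

Lemma cycle_next_prev x : x \in c -> next c x != prev c x.
Proof.
by case/andP: Cc => _ sz; apply: next_neq_prev => //; exact: cycle_uniq.
Qed.

(* The right end [b] of a chord separates the nodes left of it from those right
   of it, so a cycle through a node left of [b] stays left of [b]. *)
Lemma cycle_left (lo b : nat) (x : V) : chord lo b -> x \in c -> lo <= x -> x < b ->
  (exists2 y, y \in c & val y = b) -> forall z, z \in c -> z <= b.
Proof.
move=> Clb xc lox xb [y yc yb] z zc.
have [i s Es] := rot_to yc.
have: path fadj y s /\ uniq (y :: s).
  case/andP: Cc => /andP[Cyc U] _; rewrite -Es rot_uniq; split=> //.
  by move: Cyc; rewrite -(rot_cycle i) Es /= rcons_path => /andP[].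
have zs : z \in y :: s by rewrite -Es mem_rot.
have xs : x \in y :: s by rewrite -Es mem_rot.
have side (u v : V) : fadj u v -> u != y -> v != y -> (u < b) = (v < b).
  move=> /fadjP uv; rewrite -!val_eqE /= yb => ub vb.
  have := ltn_ord u; have := ltn_ord v.
  by move: uv Clb; rewrite /forward /chord; clear -ub vb; lia.
case=> + /= /andP[yNs _].
move: zs xs; rewrite !inE.
case/predU1P=> [->|zs]; first by rewrite yb.
case/predU1P=> [exy|xs]; first by rewrite exy yb ltnn in xb.
have alls (u : V) t : path fadj u t -> y \notin u :: t ->
    forall v, v \in u :: t -> (v < b) = (u < b).
  elim: t u => [|w t IH] u /=; first by move=> _ _ v; rewrite inE => /eqP ->.
  case/andP=> uw Pt; rewrite inE negb_or => /andP[uy wt] v.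
  rewrite inE => /predU1P[->//|vt].
  rewrite (IH w) // (side u w) // 1?eq_sym //.
  by move: wt; rewrite inE negb_or eq_sym => /andP[].
case: s {Es} yNs zs xs => [//|w s] yNs zs xs /= /andP[_ Ps].
by have := alls w s Ps yNs z zs; rewrite -(alls w s Ps yNs x xs) xb => /ltnW.
Qed.

(** The least node of a cycle has two distinct neighbours above it, so one of them is the end of a
    chord. The inner nodes of the block under this chord have only two neighbours in it, so the
    cycle runs through them one by one. *)
Lemma cycle_block : exists lo b, [/\ chord lo b,
  forall x, x \in c -> lo <= x <= b &
  forall x : V, lo <= x <= b -> x \in c].
Proof.
case/andP: (Cc) => _ sz.
have /hasP[x0 x0c _] : has predT c by case: (c) sz.
case: (@arg_minnP _ x0 (mem c) val x0c) => lo loc lomin.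
have up (x : V) : fadj lo x -> x \in c -> forward lo x.
  move=> /fadjP[//|/forward_lt lt] /lomin; by rewrite leqNgt lt.
have nc : next c lo \in c by rewrite mem_next.
have pc : prev c lo \in c by rewrite mem_prev.
have := cycle_next_prev loc.
have := up _ (cycle_next loc) nc; have := up _ (cycle_prev loc) pc.
have [b [Clb bc]] : exists b : V, chord lo b /\ b \in c.
  have := cycle_next_prev loc.
  have := up _ (cycle_next loc) nc; have := up _ (cycle_prev loc) pc.
  rewrite {1 2}/forward -val_eqE /=.
  case: (boolP (chord lo (next c lo))) => [? _ _ _|_]; first by exists (next c lo).
  case: (boolP (chord lo (prev c lo))) => [? _ _ _|_]; first by exists (prev c lo).
  by lia.
move=> fp fn np.
have cb z : z \in c -> z <= b.
  move=> zc; apply: (cycle_left Clb loc) => //; last by exists b.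
  exact: ltn_trans (chord_lt Clb).
exists lo, b; split=> //.
  by move=> x xc; rewrite lomin // cb.
have climb (x : V) : lo < x -> x < b -> x \in c ->
    exists2 y, y \in c & val y = x.+1.
  move=> lx xb xc.
  have nx : next c x \in c by rewrite mem_next.
  have px : prev c x \in c by rewrite mem_prev.
  have := cycle_next_prev xc.
  have [/andP[ln nb] /andP[lp pb]] : lo <= next c x <= b /\ lo <= prev c x <= b.
    by rewrite !lomin ?cb.
  case: (eqVneq (val (next c x)) x.+1) => [e|ne]; first by exists (next c x).
  case: (eqVneq (val (prev c x)) x.+1) => [e|ne']; first by exists (prev c x).
  have low (y : V) : fadj x y -> lo <= y -> y <= b -> val y != x.+1 -> x = y.+1 :> nat.
    move=> /fadjP[] F loy yb /eqP ney.
      by case: (block_forward Clb (ltnW lx) yb F) => // -[e]; rewrite e ltnn in lx.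
    by case: (block_forward Clb loy (ltnW xb) F) => // -[_ e]; rewrite e ltnn in xb.
  have := low _ (cycle_next xc) ln nb ne; have := low _ (cycle_prev xc) lp pb ne'.
  by rewrite -val_eqE /= => -> [->]; rewrite eqxx.
have lo1 : exists2 y, y \in c & val y = lo.+1.
  case: (block_forward Clb (leqnn lo) (cb _ pc) fp) => [e|[_ ep]].
    by exists (prev c lo).
  case: (block_forward Clb (leqnn lo) (cb _ nc) fn) => [e|[_ en]].
    by exists (next c lo).
  by move: np; rewrite -val_eqE /= ep en eqxx.
move=> x /andP[lox xb].
have: forall d, lo + d <= b -> exists2 y, y \in c & val y = lo + d.
  elim=> [|d IH] ld; first by exists lo => //; rewrite addn0.
  have [//| y yc yE] := IH _; first by clear -ld; lia.
  case: (posnP d) yE => [->|d0] yE; first by rewrite addn1.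
  have [| |z zc zE] := climb y _ _ yc; rewrite ?yE; try by clear -ld d0; lia.
  by exists z => //; rewrite zE yE addnS.
move=> /(_ (x - lo)) [|y yc yE]; first by clear -lox xb; lia.
by suff -> : x = y by []; apply: val_inj; rewrite /= yE subnKC.
Qed.

(** A node has just two neighbours inside its block, so both edges to them lie on the cycle; thus
    the block determines the edge set. *)
Lemma cycle_edges_block lo b : chord lo b ->
  (forall x, x \in c -> lo <= x <= b) ->
  (forall x : V, lo <= x <= b -> x \in c) ->
  cycle_edges c = [set [set p.1; p.2] | p in
    [set p : V * V | [&& fadj p.1 p.2, lo <= p.1 <= b & lo <= p.2 <= b]]].
Proof.
move=> Clb inb inc; apply/setP => E; apply/imsetP/imsetP.
  case=> x; rewrite inE => xc ->; exists (x, next c x) => //.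
  by rewrite inE /= cycle_next // !inb // mem_next.
case=> -[u v]; rewrite inE /= => /and3P[uv hu hv] ->.
wlog fuv : u v uv hu hv / forward u v.
  move=> H; case/fadjP: (uv) => ?; first exact: H.
  by rewrite setUC; apply: H => //; rewrite fadj_sym.
have uc := inc _ hu; have vc := inc _ hv.
have [e|ne] := eqVneq (next c u) v; first by exists u; rewrite ?inE // e.
have [e|ne'] := eqVneq (prev c u) v.
  by exists v; rewrite ?inE // -e next_prev ?cycle_uniq // setUC.
have := cycle_next_prev uc.
have nx : next c u \in c by rewrite mem_next.
have px : prev c u \in c by rewrite mem_prev.
have /andP[ln nb] := inb _ nx; have /andP[lp pb] := inb _ px.
have {}ne : next c u <> v :> nat by apply/eqP.
have {}ne' : prev c u <> v :> nat by apply/eqP.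
case/andP: hu hv => lu ub /andP[lv vb].
have := block_forward Clb lu vb fuv.
have nbr (y : V) : fadj u y -> lo <= y -> y <= b -> y <> v :> nat ->
    (y = u.+1 :> nat \/ u = lo :> nat /\ y = b :> nat) \/ u = y.+1 :> nat.
  move=> /fadjP[] F ly yb _; first by left; exact: block_forward Clb lu yb F.
  right; case: (block_forward Clb ly ub F) => // -[_ e].
  by have := forward_lt fuv; rewrite ltnNge -e in vb *; rewrite vb.
have := nbr _ (cycle_next uc) ln nb ne; have := nbr _ (cycle_prev uc) lp pb ne'.
rewrite -val_eqE /=; clear -ne ne' ln lp ub vb lv lu nb pb; lia.
Qed.

End Cycle.

Lemma chord_uniq a b b' : chord a b -> chord a b' -> b = b'.
Proof. by clear -Kn; rewrite /chord; lia. Qed.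

Lemma chord_sep a b a' b' : chord a b -> chord a' b' -> a < a' -> b <= a'.
Proof. by clear -Kn; rewrite /chord; lia. Qed.

(** Distinct blocks meet in at most one chord end, and cycles with the same block have the same
    edges. *)
Lemma fadj_cycles c1 c2 : simple_cycle fadj c1 -> simple_cycle fadj c2 ->
    cycle_edges c1 != cycle_edges c2 ->
  #|[set x in c1] :&: [set x in c2]| <= 1.
Proof.
move=> C1 C2 ne.
have [l1 [b1 [ch1 in1 on1]]] := cycle_block C1.
have [l2 [b2 [ch2 in2 on2]]] := cycle_block C2.
have key l b l' b' (x y : V) : chord l b -> chord l' b' -> l < l' ->
    l <= x <= b -> l' <= x <= b' -> l <= y <= b -> l' <= y <= b' -> x = y.
  move=> ch ch' ll; have := chord_sep ch ch' ll.
  by move=> h1 h2 h3 h4 h5; apply: val_inj => /=; clear -h1 h2 h3 h4 h5; lia.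
apply/card_le1_eqP => x y; rewrite !inE => /andP[x1 x2] /andP[y1 y2].
case: (ltngtP l1 l2) => [ll|ll|e].
- exact: (key _ _ _ _ _ _ ch1 ch2 ll (in1 _ y1) (in2 _ y2) (in1 _ x1) (in2 _ x2)).
- exact: (key _ _ _ _ _ _ ch2 ch1 ll (in2 _ y2) (in1 _ y1) (in2 _ x2) (in1 _ x1)).
case/eqP: ne; rewrite (cycle_edges_block C1 ch1 in1 on1).
move: ch2 in2 on2; rewrite -e => ch2; rewrite -(chord_uniq ch1 ch2) => in2 on2.
by rewrite (cycle_edges_block C2 ch1 in2 on2).
Qed.

(** Neighbours are ranked by their number, so comparing ports at a node amounts to comparing nodes
    on the path. *)
Definition fport (u v : V) : nat := #|[set w : V | fadj u w & w < v]|.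

Lemma fport_lt (u v : V) : fadj u v -> fport u v < deg fadj u.
Proof.
move=> uv; apply: proper_card; apply/properP; split.
  by apply/subsetP=> w; rewrite !inE => /andP[].
by exists v; rewrite !inE // uv ltnn.
Qed.

Lemma fport_mono (u v w : V) : fadj u v -> v < w -> fport u v < fport u w.
Proof.
move=> uv vw; apply: proper_card; apply/properP; split.
  by apply/subsetP=> x; rewrite !inE => /andP[-> /ltn_trans ->].
by exists v; rewrite !inE uv ?vw // ltnn.
Qed.

Lemma fport_mon (u v w : V) : fadj u v -> fadj u w ->
  (fport u v < fport u w) = (v < w).
Proof.
move=> uv uw; case: (ltngtP v w) => [vw|wv|/val_inj ->]; last by rewrite ltnn.
  exact: fport_mono.
by apply/negbTE; rewrite -leqNgt; apply/ltnW/fport_mono.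
Qed.

Lemma fport_inj (u v w : V) : fadj u v -> fadj u w -> fport u v = fport u w -> v = w.
Proof.
move=> uv uw e; apply: val_inj => /=; case: (ltngtP v w) => // h.
  by move: (fport_mono uv h); rewrite e ltnn.
by move: (fport_mono uw h); rewrite e ltnn.
Qed.

(** Cycles of different blocks lie on different sides of [v], so their ports do not interleave;
    within one block [v] has too few neighbours for three increasing ports. *)
Lemma fport_ccw : counter_clockwise fadj fport.
Proof.
move=> c1 c2 v C1 C2 v1 v2.
have n1 := cycle_next C1 v1; have p1 := cycle_prev C1 v1.
have n2 := cycle_next C2 v2; have p2 := cycle_prev C2 v2.
rewrite !fport_mon //.
have [l1 [b1 [ch1 in1 _]]] := cycle_block C1.
have [l2 [b2 [ch2 in2 _]]] := cycle_block C2.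
have in_n1 := in1 (next c1 v); have in_p1 := in1 (prev c1 v).
have in_n2 := in2 (next c2 v); have in_p2 := in2 (prev c2 v).
rewrite !(mem_next, mem_prev) in in_n1 in_p1 in_n2 in_p2.
move: {in_n1 in_p1 in_n2 in_p2} (in_n1 v1) (in_p1 v1) (in_n2 v2) (in_p2 v2) (in1 v
  v1) (in2 v v2).
move: (next c1 v) (prev c1 v) (next c2 v) (prev c2 v) n1 p1 n2 p2 => a b c d.
have irr (x : V) : fadj v x -> x <> v :> nat.
  by move=> vx /val_inj e; rewrite e fadj_irrefl in vx.
move=> va vb vc vd ia ib ic id i1 i2; apply/negP => /and3P[ac cb bd].
have ha := irr _ va; have hb := irr _ vb; have hc := irr _ vc; have hd := irr _ vd.
case: (ltngtP l1 l2) => [ll|ll|e].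
- by have := chord_sep ch1 ch2 ll; clear -ia ib ic i1 i2 hb hc ac cb; lia.
- by have := chord_sep ch2 ch1 ll; clear -ia ib ic i1 i2 ha hc ac cb; lia.
rewrite -e in ch2 ic; rewrite -(chord_uniq ch1 ch2) in ic.
have nbr (x : V) : fadj v x -> l1 <= x <= b1 ->
    (x = v.+1 :> nat \/ v = l1 :> nat /\ x = b1 :> nat) \/
    (v = x.+1 :> nat \/ x = l1 :> nat /\ v = b1 :> nat).
  case/andP: i1 => lv vB1 /fadjP[] F /andP[lx xB].
    by left; exact: (block_forward ch1 lv xB F).
  by right; exact: (block_forward ch1 lx vB1 F).
have := nbr _ va ia; have := nbr _ vb ib; have := nbr _ vc ic.
have := chord_lt ch1; clear -ac cb ia ib ic i1; lia.
Qed.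

(* A choice of missing edges: in gate [i] the chord or the edge that enters its last
   node, and in the ring the edge between the coordinates [dep] and [dep + 1],
   counted from the root upwards ([side = true]) or downwards. *)
Record code := Code { gate : nat -> bool; side : bool; dep : nat }.

(* The inverse of the coordinate [cd] below. *)
Definition lab (b : bool) (d : nat) : nat :=
  if b then root + d else if d == 0 then root else n'.+1 - d.

Definition gate_edge (c : code) (i : nat) : {set V} :=
  [set inord (if gate c i then i.*2.+1 else i.*2.+2); inord i.*2.+3].

(** The depth is truncated at the last edge, so that every code denotes an edge of the ring. *)
Definition ring_edge (c : code) : {set V} :=
  let d := minn (dep c) (n' - root).-1 in
  [set inord (lab (side c) d); inord (lab (side c) d.+1)].

Definition missing (c : code) : {set {set V}} :=
  [set E in edges fadj | (E == ring_edge c) || (E \in [seq gate_edge c i | i <- iota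
    0 K])].

Lemma missing_sub c : missing c \subset edges fadj.
Proof. by apply/subsetP => E; rewrite inE => /andP[]. Qed.

Lemma missing_card c : #|missing c| <= K.+1.
Proof.
have -> : K.+1 = size (ring_edge c :: [seq gate_edge c i | i <- iota 0 K]).
  by rewrite /= size_map size_iota.
apply: leq_trans (card_size _); apply: subset_leq_card.
by apply/subsetP => E; rewrite inE => /andP[_]; rewrite inE.
Qed.

Lemma set2_eq (u v a b : V) : [set u; v] = [set a; b] -> u != v ->
  u = a /\ v = b \/ u = b /\ v = a.
Proof.
move=> /setP e uv; have := e u; have := e v; rewrite !inE !eqxx orbT /=.
case/esym/orP=> /eqP ev /esym/orP[]/eqP eu.
- by rewrite eu ev eqxx in uv.
- by right.
- by left.
- by rewrite eu ev eqxx in uv.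
Qed.

Lemma edges_fadj (u v : V) : ([set u; v] \in edges fadj) = fadj u v.
Proof.
apply/imsetP/idP => [[[a b]]|uv]; last by exists (u, v); rewrite ?inE.
rewrite inE /= => ab e; case: (eqVneq u v) => [euv|/(set2_eq e)].
  move: e ab; rewrite euv setUid => /setP e; have := e a; have := e b.
  by rewrite !inE !eqxx orbT => /eqP -> /eqP ->; rewrite fadj_irrefl.
by case=> -[-> ->] //; rewrite fadj_sym.
Qed.

Lemma missingE c (u v : V) : ([set u; v] \in missing c) =
  fadj u v && (([set u; v] == ring_edge c)
    || ([set u; v] \in [seq gate_edge c i | i <- iota 0 K])).
Proof. by rewrite inE edges_fadj. Qed.

Lemma ring_edge_root c (u : V) : u \in ring_edge c -> root <= u.
Proof.
rewrite !inE => /orP[]/eqP ->; rewrite inordK /lab; clear -Kn;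
  case: (side c) => /=; (try case: ifP); lia.
Qed.

Lemma gate_edgeP c i (u v : V) : i < K -> u < v -> [set u; v] = gate_edge c i ->
  u = (if gate c i then i.*2.+1 else i.*2.+2) :> nat /\ v = i.*2.+3 :> nat.
Proof.
move=> iK uv.
have lv : i.*2.+3 < n'.+1 by clear -Kn iK; lia.
have [lu lt] : (if gate c i then i.*2.+1 else i.*2.+2) < n'.+1 /\
    (if gate c i then i.*2.+1 else i.*2.+2) < i.*2.+3.
  by case: ifP => _; clear -Kn iK; lia.
case/set2_eq; first by rewrite neq_ltn uv.
  by case=> -> ->; rewrite !inordK.
by case=> eu ev; move: uv; rewrite eu ev !inordK // ltnNge (ltnW lt).
Qed.

Lemma missing_lt c (u v : V) : u < v -> [set u; v] \in missing c ->
  (root <= u /\ [set u; v] = ring_edge c) \/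
  exists i, [/\ i < K, u = (if gate c i then i.*2.+1 else i.*2.+2) :> nat
    & v = i.*2.+3 :> nat].
Proof.
move=> uv; rewrite missingE => /andP[_ /orP[/eqP e|/mapP[i]]].
  by left; split=> //; apply: (@ring_edge_root c); rewrite -e !inE eqxx.
rewrite mem_iota => /andP[_ iK] /(gate_edgeP iK uv)[-> ->].
by right; exists i.
Qed.

Local Notation rem c := (remove_edges fadj (missing c)).

Lemma rem_sym c : connect_sym (rem c).
Proof.
by apply: sym_connect_sym => u v; rewrite /remove_edges /= fadj_sym setUC.
Qed.

Lemma rem_step c (u v : V) : fadj u v -> u < v ->
    ~ (root <= u /\ [set u; v] = ring_edge c) ->
    (forall i, i < K -> u = (if gate c i then i.*2.+1 else i.*2.+2) :> nat ->
       v = i.*2.+3 :> nat -> False) ->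
  connect (rem c) u v.
Proof.
move=> uv ltuv nr ng; apply: connect1; rewrite /remove_edges /= uv /=.
apply/negP => /(missing_lt ltuv) [//|[i [iK eu ev]]]; exact: ng iK eu ev.
Qed.

Lemma fadj_succ (u v : V) : v = u.+1 :> nat -> fadj u v.
Proof. by move=> e; apply/fadjP; left; rewrite /forward e eqxx. Qed.

(** Nodes are joined to node 0 in increasing order. Where the path edge into [v] is missing, a gate
    offers its chord, and in the ring [v] is reached from the root through [n'] and downwards. *)
Lemma rem_connected c : connected_graph (rem c).
Proof.
suff H : forall d (v : V), v <= d -> connect (rem c) ord0 v.
  move=> u v; apply: (connect_trans _ (H v v (leqnn v))).
  by rewrite rem_sym; exact: (H u u (leqnn u)).
elim=> [|d IH] v vd.
  by rewrite (_ : v = ord0) //; apply: val_inj => /=; clear -vd; lia.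
case: (posnP v) => [v0|vpos]; first by apply: IH; rewrite v0.
have vn := ltn_ord v.
have [u eu] : exists u : V, v = u.+1 :> nat.
  by exists (inord v.-1); rewrite inordK ?prednK //; clear -vn vpos; lia.
have luv : u < v by rewrite eu.
have ud : u <= d by rewrite -ltnS -eu.
have cu := IH u ud.
case: (boolP ([set u; v] \in missing c)) => [/(missing_lt luv)|nm]; last first.
  apply: connect_trans cu (connect1 _).
  by rewrite /remove_edges /= (fadj_succ eu) nm.
case=> [[ru e]|[i [iK ei ev]]].
  have rn : root < n'.+1 by clear -Kn; lia.
  have cr : connect (rem c) ord0 (Ordinal rn) by apply: IH; exact: leq_trans ru ud.
  have down : forall m (x : V), x + m = n' -> v <= x -> connect (rem c) ord0 x.
    elim=> [|m IHm] x xm vx.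
      have ex : x = n' :> nat by move: xm; rewrite addn0.
      apply: connect_trans cr (rem_step _ _ _ _) => /=.
      - by apply/fadjP; left; rewrite /forward /chord ex !eqxx !orbT.
      - by clear -Kn xm; lia.
      - case=> _; rewrite -e => /set2_eq.
        case; first by rewrite -val_eqE /=; clear -Kn xm; lia.
        + by case=> /(congr1 val) /= h1 /(congr1 val) /= h2; clear -xm Kn eu h1 h2; lia.
        + by case=> /(congr1 val) /= h1 /(congr1 val) /= h2; clear -xm luv vx h1 h2;
          lia.
      - by move=> j jK ej; case: ifP ej => _; clear -jK; lia.
    have xn : x.+1 < n'.+1 by clear -xm; lia.
    have := IHm (Ordinal xn) => /= /(_ _ _) cx.
    apply: connect_trans (cx _ _) _; first by rewrite addSnnS.
      exact: leqW.
    rewrite rem_sym; apply: rem_step => //=.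
    - exact: fadj_succ.
    - case=> _; rewrite -e => /set2_eq.
      case; first by rewrite neq_ltn /= ltnSn.
      + by case=> /(congr1 val) /= h1; clear -vx luv h1; lia.
      + by case=> /(congr1 val) /= h1 /(congr1 val) /= h2; clear -luv vx h1 h2; lia.
    - by move=> j jK _; clear -jK vx ru eu; lia.
  by apply: (down (n' - v)) => //; rewrite subnKC.
case: ifP ei => gi ei; first by exfalso; clear -ei ev eu; lia.
have an : i.*2.+1 < n'.+1 by clear -iK Kn; lia.
have : connect (rem c) ord0 (Ordinal an) by apply: IH => /=; clear -ud ei; lia.
move/connect_trans; apply; apply: rem_step => /=.
- by apply/fadjP; left; rewrite /forward /chord ev /=; clear -iK; lia.
- by rewrite ev.
- by case; clear -iK; lia.
- move=> j jK; case: ifP => gj; rewrite ev => h1 h2; last by clear -h1 h2; lia.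
  have eij : i = j by clear -h2; lia.
  by rewrite eij gj in gi.
Qed.

Lemma fadj_connected : connected_graph fadj.
Proof.
move=> u v; apply: connect_sub (rem_connected (Code (fun=> true) true 0) u v).
by move=> x y /= /andP[/connect1].
Qed.

(** The model removes nothing in round 0, so the adversary acts from round 1 on; hence the
    hypotheses [0 < r] below. *)
Definition absences (f : nat -> code) (r : nat) : {set {set V}} :=
  if r == 0 then set0 else missing (f r).

Lemma absences0 f : absences f 0 = set0. Proof. by []. Qed.

Lemma absences_sub f r : absences f r \subset edges fadj.
Proof. by rewrite /absences; case: eqP => _; [exact: sub0set | exact: missing_sub]. Qed.

Lemma absences_card f r : #|absences f r| <= K.+1.
Proof. by rewrite /absences; case: eqP => _;
  [rewrite cards0 | exact: missing_card]. Qed.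

Lemma absences_connected f r : connected_graph (remove_edges fadj (absences f r)).
Proof.
rewrite /absences; case: eqP => _; last exact: rem_connected.
move=> u v; rewrite (eq_connect (e' := fadj)); first exact: fadj_connected.
by move=> x y; rewrite /remove_edges /= inE andbT.
Qed.

Definition footprint (f : nat -> code) : dynamic_cactus n'.+1 K.+1 :=
  DynamicCactus fadj_sym fadj_irrefl (conj fadj_connected fadj_cycles)
    fport_lt fport_inj fport_ccw (absences0 f) (absences_sub f)
    (absences_card f) (absences_connected f).

Definition bh_instance (f : nat ->
  code) (z : V) (hz : ord0 != z) : instance n'.+1 K.+1 :=
  @Instance _ _ (footprint f) ord0 z hz.

(** * Executions *)

Section Execution.
Variable A : algorithm.
Local Notation cfg := (config n'.+1 (K.+1 + 2)).
Local Notation ag := 'I_(K.+1 + 2).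
Implicit Types (c : code) (s : cfg) (i : ag) (z : V) (r t : nat).

Definition step c r z (hz : ord0 != z) s : cfg :=
  locked (next_config A (bh_instance (fun=> c) hz) r s).

(* [run] and [next_config] are locked, lest unification unfold whole executions. *)
Definition exec f z (hz : ord0 != z) t : cfg := locked (run A (bh_instance f hz) t).

Lemma execE f z (hz : ord0 != z) t : exec f hz t = run A (bh_instance f hz) t.
Proof. by rewrite /exec -lock. Qed.

Lemma exec_step f z (hz : ord0 != z) r :
  exec f hz r.+1 = step (f r) r hz (exec f hz r).
Proof. by rewrite /exec /step -!lock. Qed.

Lemma exec0_eq f g z z' (hz : ord0 != z) (hz' : ord0 != z') : exec f hz 0 = exec g
  hz' 0.
Proof. by rewrite !execE. Qed.

Definition pos s i : V := position (agents s i).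
Definition dead s i : bool := is_destroyed (agents s i).

Lemma exec0_pos f z (hz : ord0 != z) i : pos (exec f hz 0) i = ord0.
Proof. by rewrite execE. Qed.

Section Step.
Variables (c : code) (r : nat) (z : V) (hz : ord0 != z) (s : cfg).
Local Notation I := (bh_instance (fun=> c) hz).
Local Notation s' := (step c r hz s).

Lemma step_pos i : pos s' i = odflt (pos s i) (destination A I r s i).
Proof.
rewrite /pos /step -!lock /= /next_agent /destination.
case: (is_active (agents s i)) => //=; case: (decision A I r s i) => mem [|p|claim] //=.
by case: (target I r (position (agents s i)) p).
Qed.

Lemma destinationP i u : destination A I r s i = Some u ->
  [/\ ~~ dead s i, fadj (pos s i) u & [set pos s i; u] \notin absences (fun=> c) r].
Proof.
rewrite /destination /dead; case: ifP => //= act.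
case: (decision A I r s i).2 => // p; rewrite /target /is_missing.
case: ifP => // + E; rewrite E => /negbT miss; split=> //.
  by move: act; rewrite /is_active /is_destroyed; case: (state _).
by move: E; rewrite /neighbor; case: pickP => // w /andP[ad _] [<-].
Qed.

Lemma step_move i : pos s' i != pos s i ->
  [/\ ~~ dead s i, destination A I r s i = Some (pos s' i),
      fadj (pos s i) (pos s' i)
    & [set pos s i; pos s' i] \notin absences (fun=> c) r].
Proof.
rewrite step_pos; case E: destination => [u|] /=; last by rewrite eqxx.
by have [] := destinationP E.
Qed.

Lemma step_dead i : dead s' i = dead s i || (destination A I r s i == Some z).
Proof.
rewrite /dead /step -!lock /= /next_agent /is_destroyed /destination /is_active.
case: (state (agents s i)) => [|o|] //=.
case: (decision A I r s i) => mem [|p|claim] //=.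
case: (target I r (position (agents s i)) p) => [u|] //=.
by have -> : (Some u == Some z) = (u == z) by []; case: eqP.
Qed.

Lemma dead_stays i : dead s i -> pos s' i = pos s i /\ dead s' i.
Proof.
move=> di; rewrite step_dead di; split=> //; apply/eqP/negPn/negP.
by move=> /step_move[]; rewrite di.
Qed.

Lemma terminated_stays i claim : state (agents s i) = Terminated claim ->
  state (agents s' i) = Terminated claim /\ pos s' i = pos s i.
Proof. by move=> e; rewrite /pos /step -!lock /= /next_agent /is_active e. Qed.

End Step.

(** * Indistinguishable configurations *)

Section Agreement.
Implicit Type H : pred V.

(** To agents outside [H] the two configurations look alike: [H] contains every place where they may
    differ. *)
Definition agree H s1 s2 : Prop :=
  (forall i, agents s1 i = agents s2 i \/ H (pos s1 i) /\ H (pos s2 i)) /\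
  (forall v, ~~ H v -> board s1 v = board s2 v).

Lemma agree_refl H s : agree H s s.
Proof. by split=> // i; left. Qed.

Lemma agree_sub H H' s1 s2 : subpred H H' -> agree H s1 s2 -> agree H' s1 s2.
Proof.
move=> sub [ag bd]; split=> [i|v nv].
  by case: (ag i) => [|[/sub ? /sub ?]]; [left|right].
by apply: bd; apply: contra nv => /sub.
Qed.

Lemma agree_agent H s1 s2 i : agree H s1 s2 -> ~~ H (pos s1 i) ->
  agents s1 i = agents s2 i.
Proof. by case=> /(_ i)[//|[-> _]]. Qed.

Lemma agree_pos H s1 s2 i : agree H s1 s2 -> ~~ H (pos s1 i) -> pos s2 i = pos s1 i.
Proof. by move=> ag nH; rewrite /pos (agree_agent ag nH). Qed.

Lemma agree_in H s1 s2 i : agree H s1 s2 -> H (pos s1 i) = H (pos s2 i).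
Proof. by case=> /(_ i) + _; rewrite /pos; case=> [->|[-> ->]]. Qed.

Variables (c : code) (r : nat) (z1 z2 : V) (hz1 : ord0 != z1) (hz2 : ord0 != z2).
Local Notation I1 := (bh_instance (fun=> c) hz1).
Local Notation I2 := (bh_instance (fun=> c) hz2).

Lemma agree_view H s1 s2 v : agree H s1 s2 -> ~~ H v ->
  view_at I1 r s1 v = view_at I2 r s2 v.
Proof.
move=> agr nv; rewrite /view_at (agr.2 _ nv); congr View.
have eA i : (pos s1 i == v) || (pos s2 i == v) -> agents s1 i = agents s2 i.
  move=> h; apply: (agree_agent agr); case/orP: h => /eqP e; first by rewrite e.
  by rewrite (agree_in i agr) e.
have eP : (fun i => ~~ is_destroyed (agents s1 i) && (position (agents s1 i) == v))
       =1 (fun i => ~~ is_destroyed (agents s2 i) && (position (agents s2 i) == v)).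
  move=> i; case: (boolP ((pos s1 i == v) || (pos s2 i == v))) => [/eA -> //|].
  by rewrite negb_or /pos => /andP[/negbTE -> /negbTE ->]; rewrite !andbF.
rewrite (eq_filter eP); apply/eq_in_map => i; rewrite mem_filter => /andP[/andP[_ h] _].
by rewrite eA // /pos h orbT.
Qed.

Lemma agree_destination H s1 s2 i : agree H s1 s2 -> ~~ H (pos s1 i) ->
  destination A I1 r s1 i = destination A I2 r s2 i.
Proof.
move=> agr nH; have eA := agree_agent agr nH.
by rewrite /destination /decision -eA (agree_view agr nH).
Qed.

Lemma step_agree_pos H s1 s2 i : agree H s1 s2 -> ~~ H (pos s1 i) ->
  pos (step c r hz2 s2) i = pos (step c r hz1 s1) i.
Proof.
by move=> agr nH; rewrite !step_pos (agree_destination agr nH) (agree_pos agr nH).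
Qed.

(** Agents outside [H] see the same and act the same, so differences spread only with agents that
    start in [H], and these end in [H']. Both black holes must lie in [H'], since the fate of an
    agent entering them differs. *)
Lemma step_agree H H' s1 s2 : agree H s1 s2 -> subpred H H' ->
    H' z1 -> H' z2 ->
    (forall i, H (pos s1 i) -> H' (pos (step c r hz1 s1) i)) ->
    (forall i, H (pos s2 i) -> H' (pos (step c r hz2 s2) i)) ->
  agree H' (step c r hz1 s1) (step c r hz2 s2).
Proof.
move=> agr sub H1 H2 in1 in2; split=> [i|v nv]; last first.
  have nHv : ~~ H v by apply: contra nv => /sub.
  rewrite /step -!lock /= /next_board (agree_view agr nHv) (agr.2 _ nHv).
  congr (if _ then _ else _); apply: eq_existsb => i.
  case: (boolP (H (pos s1 i))) => [h1|h1]; last by rewrite (agree_agent agr h1).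
  have h2 : H (pos s2 i) by rewrite -(agree_in i agr).
  have n1 : (pos s1 i == v) = false by apply: contraNF nHv => /eqP <-.
  have n2 : (pos s2 i == v) = false by apply: contraNF nHv => /eqP <-.
  by rewrite /pos in n1 n2; rewrite n1 n2 !andbF.
case: (boolP (H (pos s1 i))) => [h1|h1].
  by right; split; [exact: in1 | apply: in2; rewrite -(agree_in i agr)].
have eP := step_agree_pos agr h1.
case: (boolP (H' (pos (step c r hz1 s1) i))) => h1'; first by right; rewrite eP.
left; have eD := agree_destination agr h1; move: h1'; rewrite step_pos.
rewrite /step -!lock /= /next_agent -(agree_agent agr h1) -eD.
rewrite /decision -(agree_agent agr h1) -(agree_view agr h1).
case: ifP => // _; case: (decide _ _ _) => mem [|p|claim] //.
  by case: destination => [u|] //=; case: eqP => [->|_]; rewrite ?H1 //;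
    case: eqP => [->|//]; rewrite ?H2.
case: destination => [u|] //= nu.
have -> : (u == z1) = false by apply: contraNF nu => /eqP ->.
by have -> : (u == z2) = false by apply: contraNF nu => /eqP ->.
Qed.
End Agreement.

Lemma exec_pos_bh f z (hz : ord0 != z) t i :
  pos (exec f hz t) i = z -> dead (exec f hz t) i.
Proof.
elim: t => [|t IH]; first by rewrite exec0_pos => e; have := hz; rewrite e eqxx.
rewrite exec_step => e; have [e'|ne] := eqVneq (pos (exec f hz t) i) z.
  by rewrite step_dead IH.
have := step_move (c := f t) (r := t) (hz := hz) (s := exec f hz t) (i := i).
by rewrite e eq_sym ne step_dead => -[] // _ -> _ _; rewrite eqxx orbT.
Qed.

Lemma exec_terminated f z (hz : ord0 != z) t u i claim :
    state (agents (exec f hz t) i) = Terminated claim -> t <= u ->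
  state (agents (exec f hz u) i) = Terminated claim /\
  pos (exec f hz u) i = pos (exec f hz t) i.
Proof.
move=> st /subnKC <-; elim: (u - t) => [|d [IH eP]]; first by rewrite (addn0 t).
rewrite (addnS t d) exec_step -eP.
exact: (terminated_stays (f (t + d)) (t + d) hz IH).
Qed.

Lemma solved_later f z (hz : ord0 != z) t u : solved_by A (bh_instance f hz) t ->
  t <= u -> solved_by A (bh_instance f hz) u.
Proof.
move=> [i [w [st wk]]] tu; exists i, w.
rewrite -execE in st wk; have [st' eP] := exec_terminated st tu.
rewrite -(execE f hz u); split=> //.
by rewrite -[position _]/(pos (exec f hz u) i) eP.
Qed.

(** A declaring agent is not dead, so it is outside [H] and declares the same in the other world.
    The footprint being the same, it would there name [z1] instead of [z2]. *)
Lemma agree_unsolved f z1 z2 (hz1 : ord0 != z1) (hz2 : ord0 != z2) (H : pred V) t :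
    z1 != z2 -> agree H (exec f hz1 t) (exec f hz2 t) ->
    (forall i, H (pos (exec f hz1 t) i) -> dead (exec f hz1 t) i) ->
    never_wrong A (bh_instance f hz2) ->
  ~ solved_by A (bh_instance f hz1) t.
Proof.
move=> /eqP z12 agr dH nw [i [w [st wk]]]; rewrite -execE in st wk.
have nd : ~~ H (pos (exec f hz1 t) i).
  by apply/negP => /dH; rewrite /dead /is_destroyed st.
have eA := agree_agent agr nd; rewrite eA in st wk.
have := nw t i w; rewrite -execE => /(_ st) wk2;
  have : Some z1 = Some z2 := etrans (esym wk) wk2.
by case.
Qed.

Lemma agree_trans (H : pred V) s1 s2 s3 : agree H s1 s2 -> agree H s1 s3 ->
  agree H s2 s3.
Proof.
move=> a12 a13; split=> [i|v nv]; last by rewrite -(a12.2 _ nv) (a13.2 _ nv).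
case: (boolP (H (pos s1 i))) => h.
  by right; rewrite -(agree_in i a12) -(agree_in i a13).
by left; rewrite -(agree_agent a12 h) (agree_agent a13 h).
Qed.

Lemma exec_prefix f g z (hz : ord0 != z) t :
  (forall r, r < t -> f r = g r) -> exec f hz t = exec g hz t.
Proof.
elim: t => [|t IH] e; first exact: exec0_eq.
by rewrite !exec_step IH ?e // => r rt; exact/e/ltnW.
Qed.

(* An adversary that follows [f] before round [t0] and from then on chooses the
   missing edges by inspecting the execution with black hole [z]. *)
Section Adaptive.
Variables (f : nat -> code) (t0 : nat) (sigma : cfg -> code) (z : V) (hz : ord0 != z).

(** The choices depend on the execution that they produce; computing this execution first breaks the
    circle and yields a fixed sequence of codes. *)
Fixpoint adaptive_run r : cfg :=
  if r is r'.+1 then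
    step (if r' < t0 then f r' else sigma (adaptive_run r')) r' hz (adaptive_run r')
  else exec f hz 0.

Definition adaptive r : code := if r < t0 then f r else sigma (adaptive_run r).

Lemma adaptive_runE r : exec adaptive hz r = adaptive_run r.
Proof.
elim: r => [|r IH]; first exact: exec0_eq.
by rewrite exec_step /adaptive IH.
Qed.

Lemma adaptive_lt r : r < t0 -> adaptive r = f r.
Proof. by rewrite /adaptive => ->. Qed.

Lemma adaptive_ge r : t0 <= r -> adaptive r = sigma (exec adaptive hz r).
Proof. by rewrite adaptive_runE /adaptive leqNgt => /negbTE ->. Qed.

Lemma adaptive_prefix z' (hz' : ord0 != z') t : t <= t0 ->
  exec adaptive hz' t = exec f hz' t.
Proof. by move=> tt; apply: exec_prefix => r /leq_trans/(_ tt)/adaptive_lt. Qed.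
End Adaptive.

(* Gate [i] misses its chord if somebody stands at its first node, and otherwise the
   edge at its last node: so the last agent in a gate never leaves it forwards. *)
Definition gates s (i : nat) : bool := [exists a : ag, pos s a == i.*2.+1 :> nat].

(** One agent is left behind per gate. For [i = K] this leaves at most three of the [K + 3] agents
    for the ring. *)
Definition gate_ok s : Prop := forall i : nat, i <= K ->
  i <= #|[set a : ag | pos s a <= i.*2]|.

Lemma gate_missing c (i : nat) (u v : V) : i < K -> v = i.*2.+3 :> nat ->
    u = (if gate c i then i.*2.+1 else i.*2.+2) :> nat ->
  [set u; v] \in missing c.
Proof.
move=> iK ev eu; rewrite missingE; apply/andP; split.
  apply/fadjP; left; rewrite /forward /chord eu ev.
  by case: ifP => _ /=; rewrite ?eqxx //; clear -iK; lia.
apply/orP; right; apply/mapP; exists i; first by rewrite mem_iota.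
by rewrite /gate_edge -eu -ev !inord_val.
Qed.

Lemma step_missing c r z (hz : ord0 != z) s i : 0 < r ->
    pos (step c r hz s) i != pos s i ->
  [/\ ~~ dead s i, fadj (pos s i) (pos (step c r hz s) i) &
    [set pos s i; pos (step c r hz s) i] \notin missing c].
Proof.
move=> r0 /step_move[nd _ ad]; rewrite /absences eqn0Ngt r0 => ms; by split.
Qed.

Lemma fadj_le (u v : V) (i : nat) : fadj u v -> i <= K -> u <= i.*2 -> i.*2 < v ->
  v = i.*2.+1 :> nat /\ (u = i.*2 :> nat \/ u = i.*2.-1 :> nat /\ 0 < i).
Proof.
by move=> /fadjP; rewrite /forward /chord => H iK ui iv; clear -H iK ui iv Kn; lia.
Qed.

(** One gets past [2i+2] only by entering [2i+3] from [2i+1] or [2i+2]. If nobody stands at [2i+1],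
    the edge from [2i+2] is missing and nobody passes. Otherwise the chord is missing and everybody
    up to [2i+1] stays below [2i+3]: the [i] agents up to [2i] and at least one more. *)
Lemma gate_step c r z (hz : ord0 != z) s : 0 < r -> gate_ok s -> gate c =1 gates s ->
  gate_ok (step c r hz s).
Proof.
move=> r0 ok gc [|i] iK //.
have cross a : pos s a <= i.+1.*2 -> i.+1.*2 < pos (step c r hz s) a ->
    [/\ pos (step c r hz s) a = i.*2.+3 :> nat,
      pos s a = i.*2.+2 :> nat \/ pos s a = i.*2.+1 :> nat &
      [set pos s a; pos (step c r hz s) a] \notin missing c].
  move=> pa pa'; have ne : pos (step c r hz s) a != pos s a.
    by apply: contraTneq pa' => ->; rewrite -leqNgt.
  have [_ ad nm] := step_missing r0 ne.
  have [ev [eu|[eu _]]] := fadj_le ad iK pa pa'; split=> //; [by left|by right].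
have [gi|gi] := boolP (gates s i); last first.
  apply: leq_trans (ok _ iK) _; apply: subset_leq_card.
  apply/subsetP => a; rewrite !inE => pa; rewrite leqNgt; apply/negP => /(cross _ pa).
  case=> ev [] eu; last by move/existsPn: gi => /(_ a); rewrite eu eqxx.
  by rewrite (gate_missing iK ev) // gc (negbTE gi).
have /existsP[a0 /eqP ea0] := gi.
apply: (@leq_trans #|[set a | pos s a <= i.*2.+1]|).
  apply: leq_trans (_ : #|[set a | pos s a <= i.*2]|.+1 <= _).
    by rewrite ltnS; apply: ok; exact: ltnW.
  apply: proper_card; apply/properP; split.
    by apply/subsetP => a; rewrite !inE => /leqW.
  by exists a0; rewrite !inE ea0 ?ltnn.
apply: subset_leq_card; apply/subsetP => a; rewrite !inE => pa.
rewrite leqNgt; apply/negP => /cross[]; first exact: leqW.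
move=> ev [] eu; first by rewrite eu ltnn in pa.
by rewrite (gate_missing iK ev) // gc gi.
Qed.

(** * The ring *)

(* The coordinate of a node of the ring, counted from the root in direction [b];
   it is [0] on the gates. *)
Definition cd (b : bool) (v : nat) : nat :=
  if v <= root then 0 else if b then v - root else n'.+1 - v.

Local Notation last := (n' - root).

Lemma cd_opp b (v : V) :
  v <= root /\ cd b v = 0 /\ cd (~~ b) v = 0 \/
  [/\ root < v, cd b v + cd (~~ b) v = last.+1, 0 < cd b v & 0 < cd (~~ b) v].
Proof.
rewrite /cd; case: (leqP v root) => h; first by left.
by right; have := ltn_ord v; case: b => /= vn; split; clear -h vn; lia.
Qed.

Lemma cd0 b v : v <= root -> cd b v = 0.
Proof. by rewrite /cd => ->. Qed.

Lemma cd_inj b (u v : V) : root <= u -> root <= v -> cd b u = cd b v -> u = v.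
Proof.
move=> ru rv; rewrite /cd => e; apply: val_inj => /=.
have := ltn_ord u; have := ltn_ord v; move: e.
by case: b; case: ifP; case: ifP; clear -ru rv; lia.
Qed.

Lemma cd_lab b d (z : V) : z = lab b d :> nat -> d <= last -> cd b z = d.
Proof.
rewrite /cd /lab => -> dl; case: b; first by clear -dl; case: ifP; lia.
by case: eqP => [->|d0]; rewrite ?leqnn //; clear -dl d0; case: ifP; lia.
Qed.

Lemma cd_adj b (u v : V) : fadj u v ->
  u <= root /\ v <= root \/
  [/\ root <= u, root <= v & cd b v = (cd b u).+1 \/ cd b u = (cd b v).+1 \/
    cd b u = 0 /\ cd b v = last \/ cd b v = 0 /\ cd b u = last].
Proof.
have H (x y : V) : forward x y -> x <= root /\ y <= root \/
    [/\ root <= x, root <= y & cd b y = (cd b x).+1 \/ cd b x = (cd b y).+1 \/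
      cd b x = 0 /\ cd b y = last \/ cd b y = 0 /\ cd b x = last].
  have := ltn_ord x; have := ltn_ord y; rewrite /forward /chord => yn xn.
  case/orP=> [/eqP e|/orP[/andP[/andP[_ /eqP e] yr]|/andP[/eqP ex /eqP ey]]].
  - have [yr|yr] := leqP y root; first by left; split=> //; clear -e yr; lia.
    right; split; try by clear -e yr; lia.
    rewrite /cd [y <= _]leqNgt yr /=.
    by case: b; case: ifP; clear -e yr yn; lia.
  - by left; split=> //; clear -e yr; lia.
  right; rewrite /cd ex ey leqnn; split; try by clear -Kn; lia.
  have -> : (n' <= root) = false by clear -Kn; lia.
  by case: b; clear -Kn; lia.
move=> /fadjP[/H//|/H[[? ?]|[? ? c]]]; [by left | right; split=> //].
tauto.
Qed.

Lemma ring_missing c (u v : V) : fadj u v -> root <= u -> dep c < last ->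
  cd (side c) u = dep c -> cd (side c) v = (dep c).+1 -> [set u; v] \in missing c.
Proof.
move=> uv ru dl eu ev; rewrite missingE uv; apply/orP; left; apply/eqP.
have rv : root <= v by move: ev; rewrite /cd; case: ifP => // /negbT;
  rewrite -ltnNge => /ltnW.
have lr d : d <= last -> lab (side c) d < n'.+1 /\ root <= lab (side c) d.
  by rewrite /lab; case: (side c); [clear -Kn; lia | case: eqP; clear -Kn; lia].
have nd (x : V) d : d <= last -> root <= x -> cd (side c) x = d ->
  x = inord (lab (side c) d).
  move=> dl' rx ex; have [l1 l2] := lr d dl'.
  apply: (@cd_inj (side c)) => //; first by rewrite inordK.
  by rewrite ex (@cd_lab (side c) d) // inordK.
rewrite /ring_edge (_ : minn (dep c) _ = dep c); last by clear -dl; lia.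
by rewrite -(nd u _ (ltnW dl) ru eu) -(nd v _ dl rv ev).
Qed.

(* The nodes strictly between coordinate [W] in direction [b] and coordinate [dx] in
   the opposite direction. *)
Definition zone (W : nat) (b : bool) (dx : nat) : pred V :=
  fun v => (W < cd b v) && (dx < cd (~~ b) v).

Definition occupied b d s : bool := [exists a : ag, cd b (pos s a) == d].

(* An agent outside of [zone W b dx] can enter it only while another one stands at
   coordinate [W]; so this strategy keeps a single agent out for ever. *)
Definition confine W b dx s : code :=
  if occupied b W s then Code (gates s) b W else Code (gates s) (~~ b) dx.

(** One of the two ends of the zone is blocked in each round. The end at [W] can be crossed only
    from [W] or, from the inside, from [W.+1], which the last hypothesis excludes. So the crossing
    is at the other end, while an agent at [W] draws the missing edge there. *)
Lemma cross_zone W b dx r z (hz : ord0 != z) s o : 0 < r -> 0 < W -> W < last ->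
  0 < dx ->
    dx < last ->
    zone W b dx (pos s o) != zone W b dx (pos (step (confine W b dx s) r hz s) o) ->
    (zone W b dx (pos s o) -> W.+1 < cd b (pos s o)) ->
  exists o', [/\ o' != o, cd b (pos s o') = W, root < pos s o & cd b (pos s o) <> W].
Proof.
move=> r0 W0 Wl d0 dl; set s' := step _ _ _ _ => nz hin.
have ne : pos s' o != pos s o by apply: contra nz => /eqP ->.
have [nd ad nm] := step_missing r0 ne; rewrite -/s' in ad nm.
have [[ru rv]|[ru rv hs]] := cd_adj b ad; first by move: nz; rewrite /zone !cd0.
case: (boolP (occupied b W s)) => [oc|noc].
  have [/eqP e|ne'] := boolP (cd b (pos s o) == W).
    have nW : cd b (pos s' o) <> W.+1.
      move=> e'; move/negP: nm; apply; rewrite /confine oc.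
      exact: ring_missing.
    exfalso; move: nz; rewrite /zone e ltnn /=.
    case: (cd_opp b (pos s' o)) hs => [[_ [-> _]]|[_ h1 h2 h3]]; rewrite ?ltn0 // e.
    by clear -nW Wl h1 W0; lia.
  case/existsP: oc => o' /eqP e'; exists o'; split=> //; last exact/eqP.
    by apply: contra ne' => /eqP <-; rewrite e'.
  rewrite ltn_neqAle ru andbT; apply/eqP => ero; move: nz hs; rewrite /zone.
  have -> : cd b (pos s o) = 0 by rewrite cd0 // -ero.
  case: (cd_opp b (pos s' o)) => [[_ [-> _]]|[_ h2 h3 h4]]; rewrite ?ltn0 //=.
  by clear -W0 Wl d0 dl h2 h3 h4; lia.
exfalso.
have nW : cd b (pos s o) <> W by move=> e; move/existsP: noc; apply; exists o;
  apply/eqP.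
have M1 : cd (~~ b) (pos s o) = dx -> cd (~~ b) (pos s' o) <> dx.+1.
  move=> e1 e2; move/negP: nm; apply; rewrite /confine (negbTE noc).
  by apply: ring_missing.
have M2 : cd (~~ b) (pos s' o) = dx -> cd (~~ b) (pos s o) <> dx.+1.
  move=> e1 e2; move/negP: nm; apply; rewrite /confine (negbTE noc) setUC.
  by apply: ring_missing => //=; rewrite fadj_sym.
move: nz hin; rewrite /zone.
case: (cd_opp b (pos s o)) (cd_opp b (pos s' o)) =>
  [[_ [a1 a2]]|[_ a1 a2 a3]] [[_ [a4 a5]]|[_ a4 a5 a6]];
  clear noc nm ne ad nd ru rv; lia.
Qed.

Lemma gate_ok_four s a1 a2 a3 a4 : gate_ok s -> uniq [:: a1; a2; a3; a4] ->
  ~~ all (fun a => root <= pos s a) [:: a1; a2; a3; a4].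
Proof.
move=> /(_ K (leqnn K)) ok U; apply/negP => /allP al.
have : size [:: a1; a2; a3; a4] <= #|~: [set a : ag | pos s a <= K.*2]|.
  rewrite -(card_uniqP U); apply: subset_leq_card.
  by apply/subsetP => a /al; rewrite !inE -ltnNge.
have := cardsC [set a : ag | pos s a <= K.*2].
rewrite card_ord /= => e; move: e ok; move: #|~: _| => y; move: #|_| => x.
by rewrite addn2; lia.
Qed.

Lemma gate_ok_run f z (hz : ord0 != z) t u :
    (forall r, t <= r -> gate (f r) =1 gates (exec f hz r)) -> 0 < t ->
    gate_ok (exec f hz t) -> t <= u -> gate_ok (exec f hz u).
Proof.
move=> gf t0 ok; elim: u => [|u IH]; first by rewrite leqn0 => /eqP <-.
rewrite leq_eqVlt => /predU1P[<- //|tu]; rewrite exec_step.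
by apply: gate_step; [exact: leq_trans t0 _ | exact: IH | exact: gf].
Qed.

(** Round 0 is not controlled by the adversary, but it takes nobody further than node 1. *)
Lemma gate_ok1 f z (hz : ord0 != z) : gate_ok (exec f hz 1).
Proof.
move=> [|i] // iK.
suff -> : [set a | pos (exec f hz 1) a <= i.+1.*2] = setT.
  by rewrite cardsT card_ord; clear -iK; lia.
apply/setP => a; rewrite !inE exec_step.
have [->|/step_move[_ _ ad _]] :=
  eqVneq (pos (step (f 0) 0 hz (exec f hz 0)) a) (pos (exec f hz 0) a).
  by rewrite exec0_pos.
move: ad; rewrite exec0_pos => /fadjP; rewrite /forward /chord /=.
by set v := pos _ _; rewrite -/v; clear -iK; lia.
Qed.

(* One unit of cost is paid in each round in which some agent traverses an edge of
   the ring: this bounds rounds and moves from below at the same time. *)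
Definition busy s s' : bool :=
  [exists a : ag, [&& root <= pos s a, root <= pos s' a & pos s a != pos s' a]].

Definition cost f z (hz : ord0 != z) t : nat :=
  \sum_(r < t) busy (exec f hz r) (exec f hz r.+1).

Lemma cost0 f z (hz : ord0 != z) : cost f hz 0 = 0.
Proof. by rewrite /cost big_ord0. Qed.

Lemma costS f z (hz : ord0 != z) t :
  cost f hz t.+1 = cost f hz t + busy (exec f hz t) (exec f hz t.+1).
Proof. by rewrite /cost big_ord_recr. Qed.

Lemma cost_mono f z (hz : ord0 != z) t u : t <= u -> cost f hz t <= cost f hz u.
Proof.
move=> /subnKC <-; elim: (u - t) => [|d IH]; first by rewrite (addn0 t).
by rewrite (addnS t d) costS; apply: leq_trans IH (leq_addr _ _).
Qed.

Lemma cost_le f z (hz : ord0 != z) t : cost f hz t <= t.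
Proof.
elim: t => [|t IH]; first by rewrite cost0.
rewrite costS; apply: (@leq_trans (t + 1)); last by rewrite addn1.
by apply: leq_add => //; case: busy.
Qed.

(** * The first phase *)

Section Scale.
Variables W w : nat.
Hypothesis W0 : 0 < W.
Hypothesis wW : w * w = W.
Hypothesis Wlast : 6 * W < last.

(** The cut at [3 * W] separates the two halves: as the ring is longer than [6 * W], a node has
    positive depth in at most one direction. *)
Definition depth b (v : nat) : nat := if cd b v <= 3 * W then cd b v else 0.

Definition inner s : Prop :=
  forall a : ag, cd true (pos s a) < 3 * W \/ cd false (pos s a) < 3 * W.

Lemma inner_side s b a : inner s ->
  cd b (pos s a) < 3 * W \/ cd (~~ b) (pos s a) < 3 * W.
Proof. by move=> /(_ a); case: b => /=; tauto. Qed.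

(** [depth] could jump only between coordinates [3 * W] and [3 * W + 1], and a node there is at
    least [3 * W] away from the root in both directions, against the first hypothesis. *)
Lemma depth_adj b (u v : V) : cd b u < 3 * W \/ cd (~~ b) u < 3 * W -> fadj u v ->
  [\/ depth b u = 0 /\ depth b v = 0,
      [/\ depth b v = (depth b u).+1, root <= u, root <= v,
        cd b u = depth b u & cd b v = depth b v] |
      [/\ depth b u = (depth b v).+1, root <= u & root <= v]].
Proof.
move=> inn /(cd_adj b)[[ur vr]|[ur vr h]].
  by constructor 1; rewrite /depth !cd0.
have := cd_opp b u; have := cd_opp b v; rewrite /depth.
case: (leqP (cd b u) (3 * W)) => cu; case: (leqP (cd b v) (3 * W)) => cv.
- move=> _ _; case: h => [h|[h|[[h1 h2]|[h1 h2]]]].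
  + by constructor 2.
  + by constructor 3.
  + by exfalso; clear -h2 cv Wlast; lia.
  + by exfalso; clear -h2 cu Wlast; lia.
- move=> [[_ [h0 _]]|[_ sv _ _]]; first by rewrite h0 in cv.
  move=> [[_ [h1 h2]]|[_ su _ _]]; constructor 1; split=> //.
  by clear -h inn cu cv Wlast sv su; lia.
- move=> _ [[_ [h0 _]]|[_ su _ _]]; first by rewrite h0 in cu.
  constructor 1; split=> //.
  by clear -h inn cu cv Wlast su; lia.
- by move=> _ _; constructor 1.
Qed.

Lemma depth_opp b (v : V) : 0 < depth b v -> depth (~~ b) v = 0.
Proof.
rewrite /depth; case: (cd_opp b v) => [[_ [-> ->]]|[_ e _ _]] //.
by case: ifP => // h1 _; case: ifP => // h2; clear -e h1 h2 Wlast; lia.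
Qed.

Lemma depth_step b c r z (hz : ord0 != z) s a : inner s ->
  let s' := step c r hz s in
  depth b (pos s' a) <= depth b (pos s a) + busy s s' /\
  depth b (pos s a) <= depth b (pos s' a) + busy s s'.
Proof.
move=> inn /=; set s' := step _ _ _ _.
have [->|ne] := eqVneq (pos s' a) (pos s a); first by rewrite leq_addr.
have [_ _ ad _] := step_move ne; rewrite -/s' in ad.
have B : root <= pos s a -> root <= pos s' a -> busy s s'.
  by move=> r1 r2; apply/existsP; exists a; rewrite r1 r2 eq_sym.
case: (depth_adj (inner_side b a inn) ad) => [[-> ->]//|[-> r1 r2 _ _]|[-> r1 r2]].
  by rewrite (B r1 r2); clear; lia.
by rewrite (B r1 r2); clear; lia.
Qed.

Definition maxd b s : nat := \max_(a : ag) depth b (pos s a).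

Lemma maxd_le b s : maxd b s <= 3 * W.
Proof. by apply/bigmax_leqP => a _; rewrite /depth; case: ifP. Qed.

Lemma no_advance c r z (hz : ord0 != z) s a : 0 < r -> inner s ->
    dep c = maxd (side c) s ->
  depth (side c) (pos (step c r hz s) a) <= maxd (side c) s.
Proof.
move=> r0 inn ed; set s' := step _ _ _ _.
have le : depth (side c) (pos s a) <= maxd (side c) s by exact: leq_bigmax.
have [->//|ne] := eqVneq (pos s' a) (pos s a).
have [_ ad nm] := step_missing r0 ne; rewrite -/s' in ad nm.
rewrite leqNgt; apply/negP => gt.
case: (depth_adj (inner_side (side c) a inn) ad) => [[_ h]|[h r1 r2 e1 e2]|[h _ _]].
- by rewrite h ltn0 in gt.
- have e : depth (side c) (pos s a) = maxd (side c) s.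
    by apply/eqP; rewrite eqn_leq le -ltnS -h.
  move/negP: nm; apply; apply: ring_missing => //.
  + by rewrite ed; have := maxd_le (side c) s; clear -Wlast; lia.
  + by rewrite e1 e ed.
  + by rewrite e2 h e ed.
by rewrite h in le; have := ltn_trans gt le; rewrite ltnn.
Qed.

(* At most three agents are in the ring, so one that advances beyond all others in
   its half is alone there. *)
Definition balance s : code :=
  if 1 < #|[set a : ag | 0 < depth true (pos s a)]|
  then Code (gates s) true (maxd true s) else Code (gates s) false (maxd false s).

Section Balanced.
Variables (z0 : V) (hz0 : ord0 != z0).

Definition balanced : nat -> code :=
  adaptive (fun=> Code (fun=> false) true 0) 0 balance hz0.
Local Notation R := (exec balanced hz0).
Local Notation costR := (cost balanced hz0).

Lemma balancedE r : balanced r = balance (R r).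
Proof. exact: adaptive_ge. Qed.

Lemma balanced_gate_ok t : 0 < t -> gate_ok (R t).
Proof.
apply: (@gate_ok_run _ _ _ 1) => // [r _|]; last exact: gate_ok1.
by rewrite balancedE /balance; case: ifP.
Qed.

(** A second agent in this half would make [balance] block it: the strategy cannot be occupied with
    two agents of the other half, since that would put four agents into the ring. *)
Lemma solo b r a : 0 < r -> inner (R r) -> 0 < depth b (pos (R r) a) ->
    maxd b (R r) < depth b (pos (R r.+1) a) ->
  forall o, o != a -> depth b (pos (R r) o) = 0.
Proof.
move=> r0 inn da adv o oa; apply/eqP; rewrite -leqn0 leqNgt; apply/negP => dO.
move: adv; rewrite exec_step balancedE ltnNge => /negP; apply.
rewrite /balance; case: ifP => cr.
  case: b da dO => da dO; first exact: no_advance.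
  case/card_gt1P: cr => q1 [q2 []]; rewrite !inE => d1 d2 q12.
  have excl q : 0 < depth true (pos (R r) q) -> q != a /\ q != o.
    move=> dq; have := depth_opp dq => /= e.
    by split; apply/eqP => eq; rewrite -eq e in da dO.
  have [q1a q1o] := excl _ d1; have [q2a q2o] := excl _ d2.
  have := @gate_ok_four _ q1 q2 a o (balanced_gate_ok r0).
  rewrite /= !inE !negb_or q12 q1a q1o q2a q2o eq_sym oa /= => /(_ isT).
  have rt b' q : 0 < depth b' (pos (R r) q) -> root <= pos (R r) q.
    by rewrite /depth /cd; case: (leqP (pos (R r) q) root) => // /ltnW.
  by rewrite (rt _ _ d1) (rt _ _ d2) (rt _ _ da) (rt _ _ dO).
case: b da dO => da dO; last exact: no_advance.
case/negP: cr; apply/card_gt1P; exists a, o; rewrite !inE da dO eq_sym; by split.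
Qed.

(* [w] fresh nodes are visited at cost less than [W]: they are visited by one and
   the same agent [a], out of reach of all others. *)
Record fast (b : bool) (a : ag) (X r t1 : nat) : Prop := Fast {
  fast_r : 0 < r;
  fast_lt : r < t1;
  fast_X : 2 * W <= X;
  fast_M : X + w <= 3 * W;
  fast_inner : forall t, t < t1 -> inner (R t);
  fast_before : forall t o, t <= r -> depth b (pos (R t) o) <= X;
  fast_at : depth b (pos (R r) a) = X;
  fast_next : depth b (pos (R r.+1) a) = X.+1;
  fast_fresh : forall t o, t < t1 -> depth b (pos (R t) o) < X + w;
  fast_end : exists o, depth b (pos (R t1) o) = X + w;
  fast_cost : costR t1 < costR r + W
}.

(** Depth grows by at most one per round, so no value is skipped. *)
Lemma first_visit b X t o : (forall u, u < t -> inner (R u)) -> 0 < X ->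
    X <= depth b (pos (R t) o) ->
  exists u a, [/\ u < t, forall v q, v <= u -> depth b (pos (R v) q) < X,
    (depth b (pos (R u) a)).+1 = X & depth b (pos (R u.+1) a) = X].
Proof.
move=> inn X0 Xo.
have ex : exists u, [exists q, X <= depth b (pos (R u) q)].
  by exists t; apply/existsP; exists o.
case: (ex_minnP ex) => u /existsP[q Xq] umin.
have ut : u <= t by apply: umin; apply/existsP; exists o.
case: u => [|u] in Xq umin ut *.
  by move: Xq; rewrite exec0_pos /depth /cd /= leqNgt X0.
have before v p : v <= u -> depth b (pos (R v) p) < X.
  move=> vu; rewrite ltnNge; apply/negP => Xp.
  have := umin v; rewrite ltnNge vu /= => h.
  by have : false by apply: h; apply/existsP; exists p.
exists u, q; split=> //.
  have [+ _] := depth_step b (balanced u) u hz0 q (inn _ ut).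
  rewrite -exec_step; have := before u q (leqnn u).
  by case: (busy _ _); clear -Xq; lia.
have [+ _] := depth_step b (balanced u) u hz0 q (inn _ ut).
rewrite -exec_step; have := before u q (leqnn u).
by case: (busy _ _); clear -Xq; lia.
Qed.

(** Each block of [w] new depths from [2 * W] on costs at least [W]; otherwise the rounds between
    the first visits to its two ends would be a [fast] phase. *)
Lemma slow_cost b : 0 < w -> (forall a X r t1, ~ fast b a X r t1) ->
  forall (i : nat) t o, i <= w -> (forall u, u < t -> inner (R u)) ->
    2 * W + i * w <= depth b (pos (R t) o) -> i * W <= costR t.
Proof.
move=> w0 nf; elim=> [|i IH] t o iw inn Xo; first by rewrite mul0n.
set X := 2 * W + i * w.
have X1 : 0 < X.+1 by [].
have [| r [a [rt before at_r at_r1]]] := first_visit (X := X.+1) inn X1 (o :=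
  o) (b := b).
  by apply: leq_trans Xo; rewrite /X mulSn; clear -w0; lia.
have [||u [q [ut beforeu at_u at_u1]]] := first_visit (X := X + w) inn _ (o :=
  o) (b := b).
- by clear -w0; lia.
- by apply: leq_trans Xo; rewrite /X mulSn; clear -w0; lia.
have aX : depth b (pos (R r) a) = X by case: at_r.
have ru : r <= u.
  rewrite leqNgt; apply/negP => lt.
  by have := before u.+1 q lt; rewrite at_u1; clear -w0; lia.
have cr : i * W <= costR r.
  apply: (IH r a (ltnW iw)) => [v vr|]; last by rewrite aX.
  by apply: inn; exact: ltn_trans rt.
have [ge|lt] := leqP (costR r + W) (costR u.+1).
  rewrite mulSn addnC; apply: leq_trans (_ : costR u.+1 <= _); last exact: cost_mono.
  by apply: leq_trans ge; rewrite leq_add2r.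
case: (nf a X r u.+1); split=> //.
- rewrite lt0n; apply/eqP => r0; move: aX; rewrite r0 exec0_pos /depth /cd /=.
  by rewrite /X; clear -W0; lia.
- by rewrite /X leq_addr.
- have : i.+1 * w <= w * w by rewrite leq_mul2r iw orbT.
  by rewrite wW /X mulSn; clear; lia.
- by move=> v /leq_trans/(_ ut); exact: inn.
- by exists q.
Qed.

Lemma inner_next b c r z (hz : ord0 != z) s a : inner s ->
  cd b (pos (step c r hz s) a) <= 3 * W \/ cd (~~ b) (pos (step c r hz s) a) <= 3 * W.
Proof.
move=> inn; set s' := step _ _ _ _.
have [->|ne] := eqVneq (pos s' a) (pos s a).
  by case: (inner_side b a inn) => /ltnW; tauto.
have [_ _ ad _] := step_move ne; rewrite -/s' in ad.
have half b' : cd b' (pos s a) < 3 * W ->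
    cd b' (pos s' a) <= 3 * W \/ cd (~~ b') (pos s' a) <= 3 * W.
  case: (cd_adj b' ad) => [[_ h] _|[_ _ h]]; first by rewrite cd0 //; left.
  by case: (cd_opp b' (pos s' a)) => [[_ [-> _]]|[_ e _ _]];
    [left | clear -h e W0 Wlast; lia].
by case: (inner_side b a inn) => /half //; rewrite negbK; tauto.
Qed.

Lemma gate_ok_agree (H : pred V) s1 s2 : (forall v : V, H v -> root < v) ->
  agree H s1 s2 -> gate_ok s1 -> gate_ok s2.
Proof.
move=> Hr agr ok i iK; apply: leq_trans (ok i iK) _; apply: subset_leq_card.
apply/subsetP => o; rewrite !inE => h; rewrite (agree_pos agr) //.
by apply/negP => /Hr; clear -h iK; lia.
Qed.

Section Fast.
Hypothesis z0_mid : forall b, 3 * W < cd b z0.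
Hypothesis w0 : 0 < w.
Variables (b : bool) (a : ag) (X r t1 : nat).
Hypothesis F : fast b a X r t1.

Local Notation Zone := (zone W b (3 * W)).

Lemma X_le : 2 * W <= X /\ X + w <= 3 * W.
Proof. by split; [exact: fast_X F | exact: fast_M F]. Qed.

(** These are the places where [a] may die. The minimum makes [cand j] a ring node for every [j], so
    that [cand_home] holds unconditionally. *)
Definition cand (j : nat) : V := inord (lab b (minn (X + j) last)).

Lemma cand_val j : cand j = lab b (minn (X + j) last) :> nat /\ root < cand j.
Proof.
have := X_le.1; rewrite /cand /lab => hX; rewrite inordK.
  split=> //; case: b; first by clear -hX W0 Wlast; lia.
  by case: eqP; clear -hX W0 Wlast; lia.
by case: b; [clear -Kn | case: eqP; clear -Kn]; lia.
Qed.

Lemma cand_home j : ord0 != cand j.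
Proof. by rewrite -val_eqE /=; have [_] := cand_val j; case: (nat_of_ord _). Qed.

Lemma cd_cand j : j <= w -> cd b (cand j) = X + j.
Proof.
move=> jw; rewrite (cd_lab (d := X + j)).
- by [].
- rewrite (cand_val j).1; congr lab; have := X_le.2; clear -jw Wlast; lia.
- have := X_le.2; clear -jw Wlast; lia.
Qed.

Lemma depth_cand j : j <= w -> depth b (cand j) = X + j.
Proof.
move=> jw; rewrite /depth cd_cand // ifT //.
by have := X_le.2; clear -jw; lia.
Qed.

Lemma cand_zone j : j <= w -> Zone (cand j).
Proof.
move=> jw; rewrite /zone cd_cand //; have := X_le.
case: (cd_opp b (cand j)) => [[h _]|[_ + _ _]].
  by have := (cand_val j).2; rewrite ltnNge h.
by rewrite cd_cand //; clear -jw W0 Wlast; lia.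
Qed.

Lemma at_cand j (v : V) : j <= w -> depth b v = X + j -> v = cand j.
Proof.
move=> jw dv; have hX := X_le.
have cv : cd b v = X + j.
  by move: dv; rewrite /depth; case: ifP => // _; clear -hX W0; lia.
apply: (@cd_inj b); rewrite ?cd_cand //; last exact: ltnW (cand_val j).2.
case: (leqP root v) => // h; move: cv; rewrite cd0; last exact: ltnW.
by clear -hX W0; lia.
Qed.

Lemma zone_root (v : V) dx : zone W b dx v -> root < v.
Proof. by rewrite /zone; case: (leqP v root) => // h; rewrite cd0. Qed.

(** By [solo] the others have depth 0 at round [r], and a round in which depths change costs one
    unit. The cost stays below [W] until [t1] and [X] is at least [2 * W], so [a] remains beyond [W]
    and all others before it. *)
Lemma hidden t : r <= t <= t1 ->
  (forall o, o != a -> depth b (pos (R t) o) + costR r <= costR t) /\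
  X + costR r <= depth b (pos (R t) a) + costR t.
Proof.
case/andP => /subnKC <-; elim: (t - r) => [|d IH].
  rewrite addn0 => _; split=> [o oa|]; last by rewrite (fast_at F).
  have inr := fast_inner F (fast_lt F).
  have da : 0 < depth b (pos (R r) a) by rewrite (fast_at F); have := X_le;
    clear -W0; lia.
  rewrite (solo (fast_r F) inr da) //.
  rewrite (fast_next F) ltnS; apply/bigmax_leqP => q _; exact: (fast_before F).
rewrite (addnS r d) => lt; have [IH1 IH2] := IH (ltnW lt).
have inn := fast_inner F lt.
rewrite costS; split=> [o oa|].
  have [+ _] := depth_step b (balanced (r + d)) (r + d) hz0 o inn.
  by rewrite -exec_step; have := IH1 o oa; clear; lia.
have [_ +] := depth_step b (balanced (r + d)) (r + d) hz0 a inn.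
by rewrite -exec_step; move: IH2; clear; lia.
Qed.

Lemma half_way t o : t <= t1 ->
  cd b (pos (R t) o) <= 3 * W \/ cd (~~ b) (pos (R t) o) <= 3 * W.
Proof.
case: t => [|t] tt; first by left; rewrite exec0_pos cd0.
by rewrite exec_step; apply: inner_next; exact: (fast_inner F).
Qed.

Lemma a_zone t : r <= t <= t1 ->
  Zone (pos (R t) a) /\ depth b (pos (R t) a) = cd b (pos (R t) a).
Proof.
move=> rt; have [_ ha] := hidden rt; have hX := X_le.
have ct : costR t < costR r + W.
  by apply: leq_ltn_trans (fast_cost F); apply: cost_mono; case/andP: rt.
have : W < depth b (pos (R t) a) by clear -ha hX ct W0; lia.
rewrite /depth; case: ifP => // h1 h2; split=> //; rewrite /zone h2.
by case: (cd_opp b (pos (R t) a)) => [[_ [e _]]|[_ e _ _]]; clear -h1 h2 e Wlast; lia.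
Qed.

Lemma o_zone t o : r <= t <= t1 -> o != a ->
  ~~ Zone (pos (R t) o) /\ depth b (pos (R t) o) < W.
Proof.
move=> rt oa; have [/(_ o oa) ho _] := hidden rt.
have ct : costR t < costR r + W.
  by apply: leq_ltn_trans (fast_cost F); apply: cost_mono; case/andP: rt.
have dl : depth b (pos (R t) o) < W by clear -ho ct; lia.
split=> //; rewrite /zone; have := @half_way t o (andP rt).2.
by move: dl; rewrite /depth; case: ifP => h; clear -h; lia.
Qed.

(* The world with black hole [cand j] under an adversary that agrees with
   [balanced] until [t1]. *)
Section Worlds.
Variable g : nat -> code.
Hypothesis gE : forall q, q < t1 -> g q = balanced q.
Local Notation world j := (exec g (cand_home j)).

(* Until [a] reaches [cand j], the execution is that of [balanced]; afterwards [a]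
   is dead, and the others cannot tell. *)
Definition hit j t : Prop := [/\ r < t, agree Zone (R t) (world j t),
  dead (world j t) a & pos (world j t) a = cand j].

Definition unhit j t : Prop := (forall v o, v <= t -> depth b (pos (R v) o) < X + j) /\
  agree (pred2 (cand j) z0) (R t) (world j t).

Lemma unhit_away j t o : j <= w -> t <= t1 -> depth b (pos (R t) o) < X + j ->
  ~~ pred2 (cand j) z0 (pos (R t) o).
Proof.
move=> jw tt dl; rewrite /= negb_or; apply/andP; split; apply/eqP => e.
  by move: dl; rewrite e depth_cand // ltnn.
have := half_way o tt; rewrite e; have := z0_mid b; have := z0_mid (~~ b).
by clear; lia.
Qed.

(** Before depth [X + j] is reached neither black hole is met, so the executions coincide. Only [a]
    can be the first to reach it, and by the same move it dies in world [j]. Afterwards the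
    differences stay in the zone, where nobody but [a] comes. *)
Lemma hit_or_not j t : 0 < j -> j <= w -> t <= t1 -> unhit j t \/ hit j t.
Proof.
move=> j0 jw; elim: t => [|t IH] tt.
  left; split; last by rewrite (exec0_eq _ g _ (cand_home j)); exact: agree_refl.
  move=> v o; rewrite leqn0 => /eqP ->; rewrite exec0_pos /depth cd0 // leq0n.
  by have := X_le; clear -W0; lia.
have gt := gE tt; have inn := fast_inner F tt.
have [[dl agr]|[rt agr da pa]] := IH (ltnW tt); last first.
  right; split; first exact: ltnW.
  - rewrite !exec_step gt; apply: (step_agree agr _ _ _ _ _) => //.
    + by rewrite /zone; have := z0_mid b; have := z0_mid (~~ b); clear; lia.
    + exact: cand_zone.
    + move=> i; rewrite -exec_step; case: (eqVneq i a) => [-> _|ia].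
        by have [] // := @a_zone t.+1; rewrite tt leqW // ltnW.
      by have [] // := @o_zone t i _ ia; [rewrite ltnW // ltnW|move/negP].
    + move=> i; rewrite -(agree_in i agr); case: (eqVneq i a) => [-> _|ia].
        by have [-> _] := dead_stays (balanced t) t (cand_home j) da; rewrite pa;
          exact: cand_zone.
      by have [] // := @o_zone t i _ ia; [rewrite ltnW // ltnW|move/negP].
  - by rewrite exec_step; have [] := dead_stays (g t) t (cand_home j) da.
  - by rewrite exec_step; have [->] := dead_stays (g t) t (cand_home j) da.
have away i := @unhit_away j t i jw (ltnW tt) (dl t i (leqnn t)).
have stepA (H' : pred V) : subpred (pred2 (cand j) z0) H' ->
  agree H' (R t.+1) (world j t.+1).
  move=> sub; rewrite !exec_step gt; apply: (step_agree agr sub _ _ _ _).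
  - by apply: sub; rewrite /= eqxx orbT.
  - by apply: sub; rewrite /= eqxx.
  - by move=> i h; move: (away i); rewrite h.
  - by move=> i; rewrite -(agree_in i agr) => h; move: (away i); rewrite h.
have [/existsP[o far]|/existsPn near] :=
  boolP [exists o, X + j <= depth b (pos (R t.+1) o)].
  right; have rt : r < t.+1.
    rewrite ltnNge; apply/negP => /(fast_before F o); clear -far j0; lia.
  have eo : o = a.
    apply/eqP/negPn/negP => oa; have [|_] := @o_zone t.+1 o _ oa;
      first by rewrite (ltnW rt).
    by have := X_le; clear -far; lia.
  rewrite {}eo in far.
  have pa : pos (R t.+1) a = cand j.
    apply: at_cand => //; apply/eqP; rewrite eqn_leq far andbT exec_step.
    have [+ _] := depth_step b (balanced t) t hz0 a inn.
    have := dl t a (leqnn t).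
    by case: (busy _ _); clear; lia.
  have pa' : pos (world j t.+1) a = cand j.
    by apply: etrans pa; rewrite !exec_step gt;
      exact: (step_agree_pos _ _ _ _ agr (away a)).
  have sub : subpred (pred2 (cand j) z0) Zone.
    move=> v /orP[]/eqP ->; first exact: cand_zone.
    by rewrite /zone; have := z0_mid b; have := z0_mid (~~ b); clear; lia.
  split; [exact: rt | exact: (stepA _ sub) | exact: (exec_pos_bh pa') | exact: pa'].
left; split; last exact: stepA.
move=> v o; rewrite leq_eqVlt => /predU1P[->|]; last exact: dl.
by rewrite ltnNge near.
Qed.

Lemma hit_end j : 0 < j -> j <= w -> hit j t1.
Proof.
move=> j0 jw; have [[dl _]|//] := hit_or_not j0 jw (leqnn t1).
have [o e] := fast_end F; have := dl t1 o (leqnn _); rewrite e.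
by rewrite ltn_add2l ltnNge jw.
Qed.

(** In world [j] agent [a] does not get past [cand j]. Comparing worlds [1] and [j] on this part of
    the zone allows others to enter the rest of it from the far end without learning anything. *)
Definition near_zone j : pred V := fun v => (W < cd b v) && (cd b v <= X + j).

Lemma near_sub j dx (v : V) : j <= w -> dx <= 3 * W -> near_zone j v -> zone W b dx v.
Proof.
rewrite /near_zone /zone => jw dW /andP[h1 h2]; rewrite h1; have := X_le.
by case: (cd_opp b v) => [[_ [e _]]|[_ e _ _]]; clear -h1 h2 e jw dW Wlast; lia.
Qed.

Lemma cand_near (i j : nat) : 0 < i -> i <= j -> j <= w -> near_zone j (cand i).
Proof.
move=> i0 ij jw; rewrite /near_zone cd_cand ?(leq_trans ij) //.
by have := X_le; clear -ij W0; lia.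
Qed.

Lemma world_other j t o : 0 < j -> j <= w -> r <= t <= t1 -> o != a ->
  ~~ Zone (pos (world j t) o).
Proof.
move=> j0 jw rt oa; have [nz dl] := o_zone rt oa; have hX := X_le.
case/andP: (rt) => _ tt; have [[_ agr]|[_ agr _ _]] := hit_or_not j0 jw tt.
  rewrite (agree_pos agr) //; apply: unhit_away => //.
  by clear -dl hX; lia.
by rewrite (agree_pos agr).
Qed.

Lemma world_a j t : 0 < j -> j <= w -> r <= t <= t1 -> near_zone j (pos (world j t) a).
Proof.
move=> j0 jw rt; case/andP: (rt) => _ tt;
  have [[dl agr]|[_ _ _ ->]] := hit_or_not j0 jw tt.
  have d := dl t a (leqnn t); rewrite (agree_pos agr); last exact: unhit_away.
  have [/andP[z1 _] e] := a_zone rt.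
  by rewrite /near_zone z1 -e ltnW.
exact: (cand_near j0 (leqnn j) jw).
Qed.

Lemma world_agree j t : 0 < j -> j <= w -> r <= t <= t1 ->
  agree (near_zone j) (world 1 t) (world j t).
Proof.
move=> j0 jw /andP[/subnKC <-]; elim: (t - r) => [|d IH].
  rewrite addn0 => rt.
  (* Up to round [r] nobody is deeper than [X], so neither of the two black holes has been
     entered. *)
  apply: (@agree_sub (pred2 (cand 1) (cand j))).
    by move=> v /orP[]/eqP ->; apply: cand_near.
  have : r <= r by [].
  elim: {-2}r => [|q IH] qr; first by rewrite (exec0_eq _ g _ (cand_home j));
    exact: agree_refl.
  have {}IH := IH (ltnW qr); have qt : q <= t1 by exact: ltnW (leq_trans qr rt).
  have away i : ~~ pred2 (cand 1) (cand j) (pos (world 1 q) i).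
    have [[dl agr]|[rq]] := @hit_or_not 1 q isT w0 qt;
      last by rewrite ltnNge ltnW in rq.
    have di := fast_before F (t := q) i (ltnW qr).
    have hX := X_le; rewrite (agree_pos agr); last by apply: unhit_away => //;
      clear -di; lia.
    rewrite /= negb_or; apply/andP; split; apply/eqP => e; move: di;
      rewrite e depth_cand //;
      by clear -j0; lia.
  rewrite !exec_step; apply: (step_agree IH _ _ _ _ _) => //=; rewrite ?eqxx ?orbT //.
    by move=> i h; move: (away i); rewrite /= h.
  move=> i h; have : pred2 (cand 1) (cand j) (pos (world j q) i) by [].
  by rewrite -(agree_in i IH) => h'; move: (away i); rewrite h'.
rewrite (addnS r d) => lt; have {}IH := IH (ltnW lt).
have h0 : r <= r + d <= t1 by rewrite leq_addr ltnW.
have h1 : r <= (r + d).+1 <= t1 by rewrite leqW ?leq_addr.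
have in_a i : near_zone j (pos (world 1 (r + d)) i) -> i = a.
  move=> h; apply/eqP/negPn/negP => ia; have := world_other (j := 1) isT w0 h0 ia.
  by rewrite (near_sub jw _ h).
rewrite !exec_step; apply: (step_agree IH _ _ _ _ _) => //.
- exact: cand_near.
- exact: cand_near.
- move=> i /in_a ->; rewrite -exec_step.
  have := world_a (j := 1) isT w0 h1; rewrite /near_zone => /andP[-> /=].
  by clear -j0; lia.
- by move=> i; rewrite -(agree_in i IH) => /in_a ->; rewrite -exec_step; exact: world_a.
Qed.

Lemma world_gate_ok : gate_ok (world 1 t1).
Proof.
have [_ agr _ _] := hit_end (j := 1) isT w0; apply: gate_ok_agree agr _.
  by move=> v; exact: zone_root.
by apply: balanced_gate_ok; exact: leq_ltn_trans (fast_lt F).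
Qed.
End Worlds.

(** * The second phase *)

Lemma dead_forever f z (hz : ord0 != z) t u i : dead (exec f hz t) i -> t <= u ->
  dead (exec f hz u) i /\ pos (exec f hz u) i = pos (exec f hz t) i.
Proof.
move=> di /subnKC <-; elim: (u - t) => [|d [IH <-]]; first by rewrite (addn0 t).
rewrite (addnS t d) exec_step.
by have [-> ->] := dead_stays (f (t + d)) (t + d) hz IH.
Qed.

(** The choices are computed from the world of [cand 1] alone, but the resulting sequence is played
    in all worlds [j]; [E] serves as the reference execution. *)
Definition trap : nat ->
  code := adaptive balanced t1 (confine W b (3 * W)) (cand_home 1).

Lemma trapE q : q < t1 -> trap q = balanced q.
Proof. exact: adaptive_lt. Qed.

Local Notation world j := (exec trap (cand_home j)).
Local Notation E := (world 1).
Local Notation costE := (cost trap (cand_home 1)).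

Lemma trap_ge q : t1 <= q -> trap q = confine W b (3 * W) (E q).
Proof. exact: adaptive_ge. Qed.

Lemma r_t1 : r <= t1 <= t1.
Proof. by rewrite leqnn ltnW // (fast_lt F). Qed.

Lemma t1_gt0 : 0 < t1.
Proof. exact: leq_ltn_trans (fast_lt F). Qed.

Lemma world_a_dead j t : 0 < j -> j <= w -> t1 <= t ->
  dead (world j t) a /\ pos (world j t) a = cand j.
Proof.
move=> j0 jw tt; have [_ _ da pa] := hit_end trapE j0 jw.
by have [-> ->] := dead_forever da tt.
Qed.

Lemma E_gate_ok t : t1 <= t -> gate_ok (E t).
Proof.
apply: (gate_ok_run _ t1_gt0 (world_gate_ok trapE)) => q qt.
by rewrite trap_ge // /confine; case: ifP.
Qed.

(** Progress of the search from the far end, in which the candidates come in decreasing order; [a]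
    is excluded because it lies dead at [cand 1]. *)
Definition reached j t : bool :=
  [exists o, [&& o != a, Zone (pos (E t) o) & cd b (pos (E t) o) <= X + j]].

Lemma reached_sub (i j : nat) t : i <= j -> reached i t -> reached j t.
Proof.
move=> ij /existsP[o /and3P[oa zo le]]; apply/existsP; exists o; rewrite oa zo /=.
by apply: leq_trans le _; rewrite leq_add2l.
Qed.

Lemma not_reached_start j : ~~ reached j t1.
Proof.
apply/existsPn => o; apply/negP => /and3P[oa zo _].
by have := world_other trapE (j := 1) isT w0 r_t1 oa; rewrite zo.
Qed.

Lemma unreached t o : o != a -> ~~ reached 1 t -> Zone (pos (E t) o) ->
  X + 1 < cd b (pos (E t) o).
Proof.
move=> oa /existsPn /(_ o) + zo; by rewrite oa zo /= -ltnNge.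
Qed.

Lemma crossing t o : t1 <= t -> o != a -> ~~ reached 1 t ->
    Zone (pos (E t) o) != Zone (pos (E t.+1) o) ->
  exists o', [/\ o' != o, o' != a, cd b (pos (E t) o') = W, root < pos (E t) o
    & cd b (pos (E t) o) <> W].
Proof.
move=> tt oa nr; rewrite exec_step trap_ge // => cr; have hX := X_le.
have [||||o' [o'o eo' ro no]] := cross_zone (leq_trans t1_gt0 tt) W0 _ _ _ cr.
- by clear -W0 Wlast; lia.
- by clear -W0; lia.
- by clear -W0 Wlast; lia.
- by move=> /(unreached oa nr); clear -hX W0; lia.
exists o'; split=> //; apply/eqP => e.
have [_ pa] := world_a_dead (j := 1) isT w0 tt.
by move: eo'; rewrite e pa cd_cand //; clear -hX W0; lia.
Qed.

Lemma cd_root d (v : V) : cd b v = d -> 0 < d -> root <= v.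
Proof. by move=> <- d0; rewrite leqNgt; apply/negP => /ltnW h; rewrite cd0 in d0. Qed.

Lemma cand_root j : root <= cand j.
Proof. exact: ltnW (cand_val j).2. Qed.

Lemma no_four t o1 o2 o3 : t1 <= t -> uniq [:: a; o1; o2; o3] -> root <= pos (E t) o1 ->
  root <= pos (E t) o2 -> root <= pos (E t) o3 -> False.
Proof.
move=> tt U r1 r2 r3; have := gate_ok_four (E_gate_ok tt) U.
have [_ pa] := world_a_dead (j := 1) isT w0 tt.
by rewrite /= r1 r2 r3 pa cand_root.
Qed.

(** By [crossing], entering the zone requires a further agent at [W]. Together with [a] and another
    agent already inside or entering, this would make four in the ring. *)
Lemma single t o1 o2 : t1 <= t -> (forall q, t1 <= q -> q < t -> ~~ reached 1 q) ->
    o1 != a -> o2 != a -> Zone (pos (E t) o1) -> Zone (pos (E t) o2) -> o1 = o2.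
Proof.
move=> /subnKC <-; elim: (t - t1) o1 o2 => [|d IH] o1 o2.
  rewrite addn0 => _ oa _ zo; have := world_other trapE (j := 1) isT w0 r_t1 oa.
  by rewrite zo.
rewrite (addnS t1 d) => nr oa1 oa2 z1 z2; set q := t1 + d in nr z1 z2 *.
have tq : t1 <= q by exact: leq_addr.
have nq := nr q tq (ltnSn q).
have {}IH o o' := IH o o' (fun p h1 h2 => nr p h1 (ltnW h2)).
apply/eqP/negPn/negP => ne.
have H o o' : o != a -> o' != a -> o != o' -> Zone (pos (E q.+1) o) ->
    Zone (pos (E q.+1) o') -> Zone (pos (E q) o).
  move=> oa oa' ne' zo zo'; apply/negPn/negP => nz.
  have cr : Zone (pos (E q) o) != Zone (pos (E q.+1) o) by rewrite (negbTE nz) zo.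
  have [o3 [o3o o3a e3 ro _]] := crossing tq oa nq cr.
  have [ro' n3] : root <= pos (E q) o' /\ o3 != o'.
    case: (boolP (Zone (pos (E q) o'))) => zq.
      split; first exact: ltnW (zone_root zq).
      by apply/eqP => e; move: zq; rewrite /zone -e e3 ltnn.
    have cr' : Zone (pos (E q) o') != Zone (pos (E q.+1) o') by rewrite (negbTE zq) zo'.
    have [_ [_ _ _ /ltnW -> n4]] := crossing tq oa' nq cr'.
    by split=> //; apply/eqP => e; apply: n4; rewrite -e.
  apply: (no_four tq _ (ltnW ro) ro' (cd_root e3 W0)).
  by rewrite /= !inE !negb_or ![a == _]eq_sym oa oa' o3a ne' ![_ == o3]eq_sym o3o n3.
have zq1 := H _ _ oa1 oa2 ne z1 z2; rewrite eq_sym in ne.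
have zq2 := H _ _ oa2 oa1 ne z2 z1.
by move: ne; rewrite (IH o1 o2 oa1 oa2 zq1 zq2) eqxx.
Qed.

(** Until candidate [j] is reached, only the dead [a] is in [near_zone j], so nobody alive meets a
    difference between worlds [1] and [j]. *)
Lemma trap_agree j th : 0 < j -> j <= w ->
    (forall q, t1 <= q -> q < th -> ~~ reached j q) ->
  forall t, t1 <= t -> t <= th -> agree (near_zone j) (E t) (world j t).
Proof.
move=> j0 jw nr t /subnKC <-; elim: (t - t1) => [|d IH].
  by rewrite addn0 => _; apply: (world_agree trapE) => //; exact: r_t1.
rewrite (addnS t1 d); set q := t1 + d in IH * => lt;
  have tq : t1 <= q by exact: leq_addr.
have {}IH := IH (ltnW lt).
have in_a i : near_zone j (pos (E q) i) -> i = a.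
  move=> h; apply/eqP/negPn/negP => ia; move/existsPn: (nr q tq lt) => /(_ i).
  by rewrite ia (near_sub jw _ h) //=; move: h; rewrite /near_zone => /andP[_ ->].
rewrite !exec_step; apply: (step_agree IH) => //.
- exact: cand_near.
- exact: (cand_near j0 (leqnn j) jw).
- move=> i /in_a ->; rewrite -exec_step.
  by have [_ ->] := world_a_dead (j := 1) isT w0 (leqW tq); exact: cand_near.
- move=> i; rewrite -(agree_in i IH) => /in_a ->; rewrite -exec_step.
  by have [_ ->] := world_a_dead j0 jw (leqW tq); exact: (cand_near j0 (leqnn j) jw).
Qed.

(** Just before its arrival [o] is outside the region of disagreement, so in world [j] it makes the
    same move, there into the black hole. *)
Lemma arrival_agree j t o : 0 < j -> j <= w -> t1 <= t ->
    (forall q, t1 <= q -> q < t.+1 -> ~~ reached j q) -> o != a ->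
    pos (E t.+1) o = cand j ->
  dead (world j t.+1) o /\ pos (world j t.+1) o = cand j.
Proof.
move=> j0 jw tt nr oa po.
have agr := trap_agree j0 jw nr tt (leqnSn t).
have nn : ~~ near_zone j (pos (E t) o).
  apply/negP => h; move/existsPn: (nr t tt (ltnSn t)) => /(_ o).
  by rewrite oa (near_sub jw _ h) //=; move: h; rewrite /near_zone => /andP[_ ->].
have po' : pos (world j t.+1) o = cand j.
  by apply: etrans po; rewrite !exec_step; exact: (step_agree_pos _ _ _ _ agr nn).
by split; [exact: (exec_pos_bh po') | exact: po'].
Qed.

(** The zone is not entered from [W], and its far end lies beyond all candidates. As coordinates
    change by one, candidate [j] is first reached from [cand j.+1]. *)
Lemma first_reached j T : 0 < j -> j <= w -> t1 <= T -> reached j T ->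
  exists t o, [/\ t1 <= t, t < T, forall q, t1 <= q -> q < t.+1 -> ~~ reached j q,
    o != a & [/\ Zone (pos (E t) o), cd b (pos (E t) o) = X + j.+1 &
      pos (E t.+1) o = cand j]].
Proof.
move=> j0 jw tT rT.
have ex : exists u, (t1 <= u) && reached j u by exists T; rewrite tT.
case: (ex_minnP ex) => u /andP[tu ru] umin.
have uT : u <= T by apply: umin; rewrite tT.
have : t1 < u.
  by rewrite ltn_neqAle tu andbT; apply/eqP => e; move: ru;
    rewrite -e (negbTE (not_reached_start j)).
case: u => [//|t] in tu ru umin uT *; rewrite ltnS => tt.
have nr q : t1 <= q -> q < t.+1 -> ~~ reached j q.
  by move=> tq qt; apply/negP => rq; have := umin q;
    rewrite tq rq leqNgt qt => /(_ isT).
case/existsP: ru => o /and3P[oa zo le].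
have nrt := nr t tt (ltnSn t).
have nr1 : ~~ reached 1 t by apply: contra nrt; exact: reached_sub.
have far : Zone (pos (E t) o) -> X + j < cd b (pos (E t) o).
  by move=> zt; move/existsPn: nrt => /(_ o); rewrite oa zt /= -ltnNge.
have rz := zone_root zo; have hX := X_le; have cz := crossing tt oa nr1.
have ne : pos (E t.+1) o != pos (E t) o.
  apply: contraTneq le => e; rewrite -ltnNge e; apply: far; by rewrite -e.
have ad : fadj (pos (E t) o) (pos (E t.+1) o).
  by move: ne; rewrite exec_step => /step_move[].
have key : Zone (pos (E t) o) /\ cd b (pos (E t) o) = X + j.+1 /\
  cd b (pos (E t.+1) o) = X + j.
  have := cd_adj b ad; have := cd_opp b (pos (E t) o);
    have := cd_opp b (pos (E t.+1) o).
  have : Zone (pos (E t) o) \/ cd b (pos (E t) o) <> W /\ ~~ Zone (pos (E t) o).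
    case: (boolP (Zone (pos (E t) o))) => z; first by left.
    by right; split=> //; have [|o' [_ _ _ _ ?]] := cz; rewrite ?(negbTE z) ?zo.
  move: far zo le; rewrite /zone.
  move: (cd b (pos (E t) o)) (cd (~~ b) (pos (E t) o)) (cd b (pos (E t.+1) o))
    (cd (~~ b) (pos (E t.+1) o)) => c c' d d'.
  move=> far zo le nz od oc ad'.
  have {}od : d + d' = last.+1 by case: od => [[_ [e _]]|[_ e _ _] //]; move: zo;
    rewrite e ltn0.
  have oc' : c = 0 /\ c' = 0 \/ c + c' = last.+1 by case: oc => [[_ ?]|[_ ? _ _]];
    [left|right].
  have ad2 : c = 0 /\ d = 0 \/ d = c.+1 \/ c = d.+1 \/ c = 0 /\ d = last \/ d = 0 /\
    c = last.
    case: ad' => [[h1 h2]|[_ _ h]]; last by right.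
    by move: rz; rewrite ltnNge h2.
  clear -far zo le nz od oc' ad2 hX jw W0 Wlast; lia.
case: key => zt [ct cu]; exists t, o; split=> //; split=> //.
by apply: at_cand => //; rewrite /depth cu ifT //; clear -hX jw; lia.
Qed.

Lemma stuck_at_W t o : t1 <= t -> cd b (pos (E t) o) = W -> cd b (pos (E t.+1) o) <= W.
Proof.
move=> tt eW; have [->|ne] := eqVneq (pos (E t.+1) o) (pos (E t) o);
  first by rewrite eW.
move: ne; rewrite exec_step trap_ge // => ne.
have [_ + +] := step_missing (leq_trans t1_gt0 tt) ne.
set s' := step _ _ _ _ => ad nm.
have ro := cd_root eW W0.
have oc : occupied b W (E t) by apply/existsP; exists o; apply/eqP.
have nW : cd b (pos s' o) <> W.+1.
  move=> e; move/negP: nm; apply; rewrite /confine oc.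
  by apply: ring_missing => //=; clear -W0 Wlast; lia.
case: (cd_adj b ad) => [[_ h]|[_ _]]; first by rewrite cd0.
rewrite eW; case: (cd_opp b (pos s' o)) => [[_ [-> _]] //|[_ e e1 e2]].
by clear -nW W0 Wlast e e1 e2; lia.
Qed.

(* [o] visits the candidates [j.+1] and [j] too quickly in succession: in the worlds
   [j.+1] and [j] both [a] and [o] die, and the others, to whom no news has come,
   can be kept apart from it for ever. *)
Section Quick.
Hypothesis solves : solves_BHS n'.+1 K.+1 A.
Variables (j u v : nat) (o : ag).
Hypotheses (j0 : 1 < j) (jw : j < w) (tu : t1 <= u) (uv : u < v).
Hypothesis nru : forall q, t1 <= q -> q < u.+1 -> ~~ reached j.+1 q.
Hypothesis nrv : forall q, t1 <= q -> q < v.+1 -> ~~ reached j q.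
Hypotheses (oa : o != a) (pu : pos (E u.+1) o = cand j.+1).
Hypothesis quick : costE v.+1 < costE u.+1 + W.
Hypothesis pv : exists2 p, p != a & pos (E v.+1) p = cand j.

Let nr1 q : t1 <= q -> q < v.+1 -> ~~ reached 1 q.
Proof. by move=> tq qv; apply: contra (nrv tq qv); apply: reached_sub; exact: ltnW. Qed.

(* [kept_in]: since its visit to [cand j.+1], [o] has not left the zone.
   [came_out]: it left after some round, in which somebody else stood at coordinate
   [W], so that they were at least [3W] apart. *)
Definition kept_in t : Prop := agree Zone (E t) (world j.+1 t) /\ Zone (pos (E t) o).

Definition came_out t : Prop := exists t0, [/\ u < t0, t0 <= t,
  agree (zone W b W) (E t) (world j.+1 t),
  W < cd b (pos (E t) o) /\ 3 * W + costE t0 <= cd (~~ b) (pos (E t) o) + costE t &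
  forall p, p != a -> p != o -> cd b (pos (E t) p) <= W \/
    cd (~~ b) (pos (E t) p) + costE t0 <= costE t].

(** While [o] stays in the zone, it is alone there with the dead [a] by [single]. When it leaves by
    the far end, it is about [3 * W] away from the root and hence from all others; these cannot pass
    [W], and less than [W] cost remains for approaching [o] from the other side. So they never
    meet. *)
Lemma news t : u < t -> t <= v.+1 -> kept_in t \/ came_out t.
Proof.
have [dO pdo] := arrival_agree (ltn0Sn j) jw tu nru oa pu.
have hX := X_le.
move=> /subnKC <-; elim: (t - u.+1) => [|d IH].
  rewrite addn0 => _; left; split; last by rewrite pu; exact: cand_zone.
  apply: agree_sub (trap_agree (ltn0Sn j) jw nru (leqW tu) (leqnn _)) => x.
  exact: near_sub.
rewrite (addnS u.+1 d); move: (u.+1 + d) (leq_addr d u.+1) IH => q uq IH qv.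
have tq : t1 <= q by apply: leq_trans tu (ltnW uq).
have nq : ~~ reached 1 q by apply: nr1 => //; exact: ltnW.
have [daq paq] := world_a_dead (j := j.+1) isT jw tq.
have [doq poq] := dead_forever dO uq; rewrite pdo in poq.
have stay i : i = a \/ i = o -> pos (world j.+1 q.+1) i = pos (world j.+1 q) i.
  rewrite exec_step => -[] ->.
    exact: (dead_stays (trap q) q (cand_home j.+1) daq).1.
  exact: (dead_stays (trap q) q (cand_home j.+1) doq).1.
have [_ Ea] := world_a_dead (j := 1) isT w0 (leqW tq).
have cs : costE q.+1 = costE q + busy (E q) (E q.+1) by exact: costS.
have adE i : pos (E q.+1) i != pos (E q) i -> fadj (pos (E q) i) (pos (E q.+1) i).
  by rewrite exec_step => /step_move[].
have B i : pos (E q.+1) i != pos (E q) i -> root <= pos (E q) i ->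
  root <= pos (E q.+1) i ->
    nat_of_bool (busy (E q) (E q.+1)) = 1.
  move=> ne r1 r2; have -> // : busy (E q) (E q.+1).
  by apply/existsP; exists i; rewrite r1 r2 eq_sym.
have c1z dx : dx <= 3 * W -> zone W b dx (cand 1).
  by move=> dW; apply: (near_sub w0 dW); exact: cand_near.
have [[agr zo]|[t0 [ut0 t0q agr [Wo ho] hp]]] := IH (ltnW qv).
- have in_ao i : Zone (pos (E q) i) -> i = a \/ i = o.
    move=> zi; case: (eqVneq i a) => [|ia]; [by left|right].
    by apply: (single tq _ ia oa zi zo) => p h1 h2; apply: nr1 => //;
      exact: (ltn_trans h2 qv).
  have step_to dx : dx <= 3 * W -> zone W b dx (pos (E q.+1) o) ->
      agree (zone W b dx) (E q.+1) (world j.+1 q.+1).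
    move=> dW zo'.
    have sub : subpred Zone (zone W b dx).
      by move=> x; rewrite /zone => /andP[-> /(leq_ltn_trans dW)].
    rewrite !exec_step; apply: (step_agree agr sub).
    + exact: c1z.
    + by apply: sub; exact: cand_zone.
    + by move=> i; rewrite -exec_step => /in_ao[]->; rewrite ?Ea //; exact: c1z.
    + move=> i zi; have zi' := zi; rewrite -(agree_in i agr) in zi'.
      by rewrite -exec_step (stay i (in_ao i zi')); exact: sub.
  have [zo'|nzo'] := boolP (Zone (pos (E q.+1) o)); first by left; split;
    [exact: (step_to _ (leqnn _) zo') | exact: zo'].
  right; exists q.+1.
  have cr : Zone (pos (E q) o) != Zone (pos (E q.+1) o) by rewrite zo (negbTE nzo').
  have [o' [o'o o'a eo' ro _]] := crossing tq oa nq cr.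
  have far := unreached oa nq zo.
  have ne : pos (E q.+1) o != pos (E q) o by apply: contra cr => /eqP ->.
  have po : W < cd b (pos (E q.+1) o) /\ 3 * W <= cd (~~ b) (pos (E q.+1) o).
    have := cd_adj b (adE o ne); have := cd_opp b (pos (E q) o);
      have := cd_opp b (pos (E q.+1) o).
    case=> [[h1 [h2 h3]]|[_ h1 h2 h3]] [[h4 _]|[_ h4 h5 h6]]; try by move: ro;
      rewrite ltnNge h4.
      case=> [[h7 _]|[_ _ h7]]; first by move: ro; rewrite ltnNge h7.
      by move: zo; rewrite /zone; clear -h2 h4 h5 h6 h7 far hX W0 Wlast; lia.
    case=> [[h7 _]|[_ _ h7]]; first by move: ro; rewrite ltnNge h7.
    by move: zo; rewrite /zone; clear -h1 h4 h5 h6 h7 far hX W0 Wlast; lia.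
  split.
  + by rewrite ltnS ltnW.
  + exact: leqnn.
  + by apply: step_to; rewrite ?leq_pmull // /zone po.1 /=; have := po.2; clear -W0;
    lia.
  + by rewrite leq_add2r; exact: po.
  (* With [a], [o] and [o'] the ring is full: [o'] is stuck at [W], and anybody else can at most
     step onto the root. *)
  + move=> p pa po2; left; have [->|po'] := eqVneq p o'; first exact: stuck_at_W.
    have lp : pos (E q) p < root.
      rewrite ltnNge; apply/negP => rp;
        apply: (no_four tq _ (ltnW ro) (cd_root eo' W0) rp).
      rewrite /= !inE !negb_or ![a == _]eq_sym oa o'a pa [o == _]eq_sym o'o [o ==
        p]eq_sym po2.
      by rewrite eq_sym po'.
    have [->|nep] := eqVneq (pos (E q.+1) p) (pos (E q) p);
      first by rewrite cd0 // ltnW.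
    have [[_ h]|[h _ _]] := cd_adj b (adE p nep); first by rewrite cd0.
    by rewrite leqNgt lp in h.
right; exists t0.
have dl : costE q.+1 < costE t0 + W.
  apply: leq_ltn_trans (_ : costE v.+1 < _); first exact: cost_mono.
  by apply: leq_trans quick _; rewrite leq_add2r; exact: cost_mono.
have c0q : costE t0 <= costE q by exact: cost_mono.
have far : W.+1 < cd b (pos (E q) o).
  case: (boolP (Zone (pos (E q) o))) => [/(unreached oa nq)|].
    by clear -hX W0; lia.
  by rewrite /zone; case: (cd_opp b (pos (E q) o)) Wo => [[_ [-> _]]|[_ e _ _]] //;
    clear -e W0 Wlast; lia.
have Wo' : W < cd b (pos (E q.+1) o) /\
  3 * W + costE t0 <= cd (~~ b) (pos (E q.+1) o) + costE q.+1.
  have [->|ne] := eqVneq (pos (E q.+1) o) (pos (E q) o).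
    split; [exact: Wo | apply: leq_trans ho _; rewrite leq_add2l]; exact: cost_mono.
  have := B o ne; have := cd_adj b (adE o ne).
  have := cd_opp b (pos (E q) o); have := cd_opp b (pos (E q.+1) o).
  have ro : root < pos (E q) o by apply: (@zone_root _ 0); rewrite /zone Wo;
    clear -ho dl cs; lia.
  case=> [[h1 [h2 h3]]|[_ h1 h2 h3]] [[h4 _]|[_ h4 h5 h6]]; try by move: ro;
    rewrite ltnNge h4.
    case=> [[h7 _]|[_ _ h7]] _; first by move: ro; rewrite ltnNge h7.
    by clear -h2 h4 h5 h6 h7 far hX W0 Wlast ho dl cs; lia.
  case=> [[h7 _]|[r1 r2 h7]]; first by move: ro; rewrite ltnNge h7.
  by move=> /(_ r1 r2) bb; clear -h1 h4 h5 h6 h7 far hX W0 Wlast ho dl cs bb; lia.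
have out p : p != a -> p != o -> ~~ zone W b W (pos (E q) p).
  move=> pa po; have := hp p pa po; rewrite /zone; clear -dl cs; lia.
split; [exact: ut0 | exact: leqW | | exact: Wo' |].
  rewrite !exec_step; apply: (step_agree agr (fun _ h => h)).
  - by apply: c1z; rewrite leq_pmull.
  - by apply: (near_sub jw (leq_pmull _ _)) => //;
    exact: (cand_near (ltn0Sn j) (leqnn _) jw).
  - move=> i zi; rewrite -exec_step; case: (eqVneq i a) => [->|ia];
    first by rewrite Ea; apply: c1z; rewrite leq_pmull.
    case: (eqVneq i o) => [->|io]; last by move: (out i ia io); rewrite zi.
    by rewrite /zone Wo'.1; have := Wo'.2; clear -dl W0; lia.
  - move=> i zi; have zi' := zi; rewrite -(agree_in i agr) in zi'.
    rewrite -exec_step stay //; case: (eqVneq i a) => [|ia]; [by left|right].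
    by apply/eqP/negPn/negP => io; move: (out i ia io); rewrite zi'.
move=> p pa po.
have [->|ne] := eqVneq (pos (E q.+1) p) (pos (E q) p).
  by case: (hp p pa po) => h; [left | right; apply: leq_trans h _; exact: cost_mono].
have [[_ h]|[r1 r2 hb]] := cd_adj b (adE p ne); first by left; rewrite cd0.
have [[_ h]|[_ _ hnb]] := cd_adj (~~ b) (adE p ne); first by left; rewrite cd0.
have := cd_opp b (pos (E q) p); have := cd_opp b (pos (E q.+1) p).
have := @stuck_at_W q p tq; have := hp p pa po; have := B p ne r1 r2; move: hb hnb.
move: (cd b (pos (E q) p)) (cd (~~ b) (pos (E q) p)) (cd b (pos (E q.+1) p))
    (cd (~~ b) (pos (E q.+1) p)) => c c' d' d'' hb hnb bb hpp st.
case=> [[_ [e1 e2]]|[_ e1 e2 e3]]; first by left; rewrite e1.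
case=> [[_ [e4 e5]]|[_ e4 e5 e6]];
  clear -hb hnb bb hpp st e1 e2 e3 e4 e5 cs c0q W0 Wlast; lia.
Qed.

Lemma quick_false : False.
Proof.
have hX := X_le; have jw' := ltnW jw; have j0' := ltnW j0.
have tv : t1 <= v by apply: leq_trans tu (ltnW uv).
have tv1 := leqW tv.
have [dO pdo] := arrival_agree (ltn0Sn j) jw tu nru oa pu.
case: pv => p pa pp.
have [dP pdp] := arrival_agree j0' jw' tv nrv pa pp.
have nr q : t1 <= q -> q < v.+1 -> ~~ reached 1 q by exact: nr1.
(* [dx] is [3 * W] if [o] was kept in and [W] if it came out; either way only [a] and [o] are in the
   zone. *)
have [dx [dW dM agr out]] : exists dx, [/\ W <= dx, dx <= 3 * W,
    agree (zone W b dx) (E v.+1) (world j.+1 v.+1) &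
    forall i, i != a -> i != o -> ~~ zone W b dx (pos (E v.+1) i)].
  have [[agr zo]|[t0 [ut0 _ agr _ far]]] := news (leqW uv) (leqnn _).
    exists (3 * W); split; [by rewrite leq_pmull | exact: leqnn | exact: agr |].
    move=> i ia io; apply/negP => zi; case/eqP: io.
    exact: (single tv1 nr ia oa zi zo).
  exists W; split; [exact: leqnn | by rewrite leq_pmull | exact: agr |].
  have dl : costE v.+1 < costE t0 + W.
    by apply: leq_trans quick _; rewrite leq_add2r; exact: cost_mono.
  by move=> i ia io; have := far i ia io; rewrite /zone; clear -dl; lia.
have po : p = o.
  apply/eqP/negPn/negP => po; have := out p pa po.
  by rewrite pp (near_sub jw' dM) // (cand_near j0' (leqnn j) jw').
rewrite {}po {p pa} in pp dP pdp.
(* From now on the adversary watches world [j.+1], where both [a] and [o] are dead. *)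
pose f3 := adaptive trap v.+1 (confine W b dx) (cand_home j.+1).
have eqw (x : nat) : exec f3 (cand_home x) v.+1 = world x v.+1 by exact:
  adaptive_prefix.
have agr0 : agree (zone W b dx) (world j.+1 v.+1) (world j v.+1).
  apply: agree_trans agr (agree_sub _ (trap_agree j0' jw' nrv tv1 (leqnn _))).
  by move=> x; exact: near_sub.
have [da1 pa1] := world_a_dead (ltn0Sn j) jw tv1.
have [da2 pa2] := world_a_dead j0' jw' tv1.
have [do1 po1] := dead_forever dO (leqW uv : u.+1 <= v.+1); rewrite pdo in po1.
have z1 : zone W b dx (cand j.+1).
  by apply: (near_sub jw dM); exact: (cand_near (ltn0Sn j) (leqnn _) jw).
have z2 : zone W b dx (cand j).
  by apply: (near_sub jw' dM); exact: (cand_near j0' (leqnn _) jw').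
have gok : gate_ok (world j.+1 v.+1).
  apply: gate_ok_agree agr (E_gate_ok tv1) => x; exact: zone_root.
have D (x : nat) i t : dead (world x v.+1) i -> pos (world x v.+1) i = cand x ->
  v.+1 <= t ->
    dead (exec f3 (cand_home x) t) i /\ pos (exec f3 (cand_home x) t) i = cand x.
  rewrite -!eqw => di pi vt; have [d1 p1] := dead_forever di vt.
  by split; [exact: d1 | exact: etrans p1 pi].
have ded t : v.+1 <= t ->
  [/\ dead (exec f3 (cand_home j.+1) t) a /\
    pos (exec f3 (cand_home j.+1) t) a = cand j.+1,
    dead (exec f3 (cand_home j.+1) t) o /\
      pos (exec f3 (cand_home j.+1) t) o = cand j.+1,
    dead (exec f3 (cand_home j) t) a /\ pos (exec f3 (cand_home j) t) a = cand j &
    dead (exec f3 (cand_home j) t) o /\ pos (exec f3 (cand_home j) t) o = cand j].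
  by move=> vt; split; exact: (D _ _ _ _ _ vt).
have ok t : v.+1 <= t -> gate_ok (exec f3 (cand_home j.+1) t).
  apply: (@gate_ok_run f3 _ (cand_home j.+1) v.+1 t _ (ltn0Sn v)).
    by move=> q qv; rewrite /f3 adaptive_ge // /confine; case: ifP.
  by rewrite eqw; exact: gok.
have inv t : v.+1 <= t ->
    agree (zone W b dx) (exec f3 (cand_home j.+1) t) (exec f3 (cand_home j) t) /\
    forall i, i != a -> i != o -> ~~ zone W b dx (pos (exec f3 (cand_home j.+1) t) i).
  move=> /subnKC <-; elim: (t - v.+1) => [|d [IH1 IH2]].
    rewrite addn0 !eqw; split; first exact: agr0.
    by move=> i ia io; rewrite (agree_pos agr) out.
  rewrite (addnS v.+1 d); move: (v.+1 + d) (leq_addr d v.+1) IH1 IH2 => q vq IH1 IH2.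
  have [[daq paq] [doq poq] [daq' paq'] [doq' poq']] := ded q vq.
  have [[_ paq1] [_ poq1] [_ paq1'] [_ poq1']] := ded q.+1 (leqW vq).
  have in_ao i : zone W b dx (pos (exec f3 (cand_home j.+1) q) i) -> i = a \/ i = o.
    case: (eqVneq i a) => [|ia zi]; first by left.
    by right; apply/eqP/negPn/negP => io; move: (IH2 i ia io); rewrite zi.
  split.
    rewrite !exec_step; apply: (step_agree IH1 (fun _ h => h) z1 z2).
      by move=> i; rewrite -exec_step => /in_ao[]->; rewrite ?paq1 ?poq1.
    by move=> i; rewrite -(agree_in i IH1) -exec_step => /in_ao[]->;
      rewrite ?paq1' ?poq1'.
  move=> i ia io; apply/negP => zi; have nzi := IH2 i ia io.
  have : zone W b dx (pos (exec f3 (cand_home j.+1) q) i) !=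
      zone W b dx (pos (exec f3 (cand_home j.+1) q.+1) i) by rewrite (negbTE nzi) zi.
  rewrite exec_step {2}/f3 adaptive_ge // => cr.
  (* An intruder [i] needs an agent [i'] at [W]; the dead [a] and [o] still count for the gates, so
     these would be four agents in the ring. *)
  have [|||||i' [i'i ei' ri _]] := cross_zone (leq_trans _ vq) W0 _ _ _ cr.
  - by [].
  - by clear -W0 Wlast; lia.
  - by clear -W0 dW; lia.
  - by clear -dM W0 Wlast; lia.
  - by rewrite (negbTE nzi).
  have ne' (x : ag) : pos (exec f3 (cand_home j.+1) q) x = cand j.+1 -> i' != x.
    by move=> px; apply/eqP => e; move: ei'; rewrite e px cd_cand //; clear -hX W0; lia.
  have := @gate_ok_four _ a o i i' (ok q vq).
  rewrite /= !inE !negb_or (eq_sym a o) (eq_sym a i) (eq_sym a i') (eq_sym o i)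
    (eq_sym o i').
  rewrite (eq_sym i i') oa ia io i'i !ne' //=.
  by rewrite paq poq !cand_root (ltnW ri) (cd_root ei' W0) => /(_ isT).
have [_ [T sT]] := solves (bh_instance f3 (cand_home j.+1)).
have [nw _] := solves (bh_instance f3 (cand_home j)).
have sT' := solved_later sT (leq_maxl T v.+1).
have vT : v.+1 <= maxn T v.+1 by exact: leq_maxr.
have [agT outT] := inv _ vT.
apply: (agree_unsolved _ agT _ nw sT').
  apply/eqP => /(congr1 (fun x : V => cd b x)); rewrite !cd_cand //; clear; lia.
have [[d1 _] [d2 _] _ _] := ded _ vT.
move=> i zi; case: (eqVneq i a) => [->//|ia]; case: (eqVneq i o) => [->//|io].
by move: (outT i ia io); rewrite zi.
Qed.
End Quick.

(** The candidates are reached one after another from the far end, and by [quick_false] each further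
    one costs [W]. The bound on [d] keeps the index [j] in the induction step above 1. *)
Lemma reached_cost d T : solves_BHS n'.+1 K.+1 A -> d.+2 <= w -> t1 <= T ->
  reached (w - d) T -> d * W <= costE T.
Proof.
move=> solves; elim: d T => [//|d IH] T dw tT rT.
set j := w - d.+1 in rT.
have [j1 jw ej] : [/\ 1 < j, j < w & w - d = j.+1].
  by rewrite /j; split; clear -dw; lia.
have j0 := ltnW j1; have hX := X_le.
have [v [p [tv vT nrv pa [zp cp pp]]]] := first_reached j0 (ltnW jw) tT rT.
have rv : reached j.+1 v by apply/existsP; exists p; rewrite pa zp cp leqnn.
have [u [o [tu uv nru oa [_ _ po]]]] := first_reached (ltn0Sn j) jw tv rv.
have cu : d * W <= costE u.+1.
  apply: (IH u.+1 (ltnW dw) (leqW tu)); rewrite ej; apply/existsP; exists o.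
  by rewrite oa po cand_zone // cd_cand // leqnn.
have [le|lt] := leqP (costE u.+1 + W) (costE v.+1); last first.
  by exfalso; apply: (quick_false solves j1 jw tu uv nru nrv oa po lt); exists p.
rewrite mulSn addnC; apply: leq_trans (cost_mono trap (cand_home 1) vT).
by apply: leq_trans le; rewrite leq_add2r.
Qed.

(** As long as candidate 2 is not reached, the black holes [cand 1] and [cand 2] are
    indistinguishable and no correct declaration is possible. Reaching it is the case [d = w - 2] of
    [reached_cost]. *)
Lemma trap_cost T : solves_BHS n'.+1 K.+1 A -> 1 < w ->
  solved_by A (bh_instance trap (cand_home 1)) T -> (w - 2) * W <= costE T.
Proof.
move=> solves w1 sT.
have tT : t1 <= maxn T t1 by exact: leq_maxr.
have [/existsP[[q qT] /= /andP[tq rq]]|/existsPn nr] :=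
    boolP [exists q : 'I_(maxn T t1).+1, (t1 <= q) && reached 2 q].
  have qT' : q <= T.
    move: qT; rewrite ltnS leq_max => /orP[//|qt].
    have e : q = t1 by apply/eqP; rewrite eqn_leq qt.
    by move: rq; rewrite e (negbTE (not_reached_start 2)).
  apply: leq_trans (cost_mono trap (cand_home 1) qT').
  by apply: reached_cost => //; [clear -w1; lia | rewrite subKn].
exfalso; have nr2 q : t1 <= q -> q < (maxn T t1).+1 -> ~~ reached 2 q.
  by move=> tq qT; have := nr (Ordinal qT); rewrite /= tq.
have agr := trap_agree (j := 2) isT w1 nr2 tT (leqnSn _).
have [nw _] := solves (bh_instance trap (cand_home 2)).
have sT' := solved_later sT (leq_maxl T t1).
apply: (agree_unsolved _ agr _ nw sT').
  by apply/eqP => /(congr1 (fun x : V => cd b x)); rewrite !cd_cand //; clear; lia.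
move=> i; case: (eqVneq i a) => [-> _|ia zi].
  by have [] := world_a_dead (j := 1) isT w0 tT.
move/existsPn: (nr2 _ tT (ltnSn _)) => /(_ i); rewrite ia (near_sub w1 (leqnn _) zi) /=.
by move/andP: zi => [_ ->].
Qed.
End Fast.

(** To tell [z0] from [z1] somebody must come as far as [3 * W] in both directions, which costs
    [w * W] by [slow_cost]. *)
Lemma balanced_cost (z1 : V) (hz1 : ord0 != z1) T : (forall b, 3 * W < cd b z0) ->
    (forall b, 3 * W <= cd b z1) -> z0 != z1 ->
    (forall b a X r t1, ~ fast b a X r t1) -> 0 < w -> solves_BHS n'.+1 K.+1 A ->
  solved_by A (bh_instance balanced hz0) T -> w * W <= costR T.
Proof.
move=> m0 m1 z01 nf w0 solves sT.
pose outer t := [exists i : ag,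
  (3 * W <= cd true (pos (R t) i)) && (3 * W <= cd false (pos (R t) i))].
have inn t : ~~ outer t -> inner (R t).
  by move=> /existsPn no i; move: (no i); rewrite negb_and -!ltnNge => /orP.
have [ex|no] := boolP [exists q : 'I_T.+1, outer q].
  have ex' : exists q, outer q by case/existsP: ex => q oq; exists q.
  case: (ex_minnP ex') => q oq qmin.
  have qT : q <= T by case/existsP: ex => -[x xT] /= /qmin/leq_trans; apply.
  apply: leq_trans (cost_mono balanced hz0 qT).
  have before u : u < q -> inner (R u).
    by move=> uq; apply: inn; apply/negP => /qmin; rewrite leqNgt uq.
  case: q => [|q] in oq qmin qT before *.
    by case/existsP: oq => i;
      rewrite exec0_pos cd0 // leqn0 muln_eq0 /= -leqn0 leqNgt W0.
  case/existsP: oq => i /andP[o1 o2].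
  have [b eb] : exists b, cd b (pos (R q.+1) i) = 3 * W.
    have := inner_next true (balanced q) q hz0 i (before q (ltnSn q)).
    by rewrite -exec_step => -[h|h]; [exists true | exists false]; apply/eqP;
      rewrite eqn_leq h.
  have nfb a X r t1 : ~ fast b a X r t1 by exact: nf.
  apply: (slow_cost w0 nfb (t := q.+1) (o := i) (leqnn w) before).
  by rewrite /depth eb leqnn wW; clear; lia.
exfalso; have inn' q : q <= T -> inner (R q).
  by move=> qT; apply: inn; move/existsPn: no => /(_ (Ordinal (qT : q < T.+1))).
have away q i : q <= T -> ~~ pred2 z0 z1 (pos (R q) i).
  move=> qT; apply/negP => /orP[]/eqP e; have := inn' q qT i; rewrite e.
    by have := m0 true; have := m0 false; clear; lia.
  by have := m1 true; have := m1 false; clear; lia.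
have agr q : q <= T -> agree (pred2 z0 z1) (R q) (exec balanced hz1 q).
  elim: q => [_|q IH qT]; first by rewrite (exec0_eq _ balanced _ hz1);
    exact: agree_refl.
  have {}IH := IH (ltnW qT).
  rewrite !exec_step; apply: (step_agree IH (fun _ h => h)); rewrite /= ?eqxx ?orbT //.
    by move=> i h; move: (away q i (ltnW qT)); rewrite /= h.
  move=> i h; have : pred2 z0 z1 (pos (exec balanced hz1 q) i) by [].
  by rewrite -(agree_in i IH) => h'; move: (away q i (ltnW qT)); rewrite h'.
have [nw _] := solves (bh_instance balanced hz1).
apply: (agree_unsolved z01 (agr T (leqnn T)) _ nw sT).
by move=> i h; move: (away T i (leqnn T)); rewrite h.
Qed.
End Balanced.

Lemma costly_instance : 1 < w -> solves_BHS n'.+1 K.+1 A ->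
  exists f (z : V) (hz : ord0 != z), forall T,
    solved_by A (bh_instance f hz) T -> (w - 2) * W <= cost f hz T.
Proof.
move=> w1 solves.
(* [z0] and [z1] are two neighbouring nodes at coordinates [3 * W + 1] and [3 * W], out of reach as
   long as [inner] holds. *)
have mk d : 3 * W <= d -> d <= (3 * W).+1 -> exists z : V,
    [/\ ord0 != z, cd true z = d & cd false z = last.+1 - d].
  move=> d1 d2; have zn : root + d < n'.+1 by clear -d2 Wlast Kn; lia.
  exists (Ordinal zn); rewrite /cd /= leqNgt;
    have -> : root < root + d by clear -d1 W0; lia.
  by split=> //=; clear -Wlast Kn; lia.
have [z0 [hz0 a0 b0]] := mk (3 * W).+1 (leqnSn _) (leqnn _).
have [z1 [hz1 a1 b1]] := mk (3 * W) (leqnn _) (leqnSn _).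
have m0 b : 3 * W < cd b z0 by case: b; rewrite ?a0 ?b0 //; clear -Wlast; lia.
have m1 b : 3 * W <= cd b z1 by case: b; rewrite ?a1 ?b1 //; clear -Wlast; lia.
have w0 := ltnW w1.
case: (classic (exists b a X r t1, fast hz0 b a X r t1)) => [[b [a [X [r [t1 F]]]]]|nf].
  exists (trap F), (cand b X 1), (cand_home F 1) => T; exact: trap_cost.
exists (balanced hz0), z0, hz0 => T sT.
apply: leq_trans (_ : w * W <= _); first by rewrite leq_mul2r leq_subr orbT.
apply: (balanced_cost (hz0 := hz0) hz1 m0 m1 _ _ w0 solves sT).
  by apply/eqP => e; move: a0; rewrite e a1; clear; lia.
by move=> b a X r t1 F; apply: nf; exists b, a, X, r, t1.
Qed.
End Scale.

(** * Rounds and moves *)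

Lemma moves_step c r z (hz : ord0 != z) s :
  moves (step c r hz s) = moves s + #|[set i | destination A (bh_instance (fun=> c)
    hz) r s i]|.
Proof. by rewrite /step -lock. Qed.

(** [G] counts the rounds with a move that starts before the root. Such a move advances by at most
    two nodes before the root, so getting to node [2K+1] takes [K+1] of these rounds. A gate move
    and a ring move of the same round belong to different agents, so both counts add up. *)
Lemma moves_cost f z (hz : ord0 != z) T : 0 < cost f hz T ->
  cost f hz T + K.+1 <= moves (exec f hz T).
Proof.
suff [G [h1 _ h2]] : exists G, [/\ G + cost f hz T <= moves (exec f hz T),
    forall i, minn (pos (exec f hz T) i) root <= 2 * G & 0 < cost f hz T ->
      root <= 2 * G].
  by move=> /h2 h3; clear -h1 h3; lia.
elim: T => [|T [G [h1 h2 h3]]].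
  by exists 0; rewrite cost0; split=> // i; rewrite exec0_pos min0n.
pose gm := [exists i,
  (pos (exec f hz T) i < root) && (pos (exec f hz T.+1) i != pos (exec f hz T) i)].
exists (G + gm); rewrite costS; set bz := busy _ _; split.
- rewrite exec_step moves_step.
  suff : gm + bz <= #|[set i | destination A (bh_instance (fun=> f T) hz) T (exec f
    hz T) i]|.
    by move: h1; clear; lia.
  have mv i : pos (exec f hz T.+1) i != pos (exec f hz T) i ->
      i \in [set i | destination A (bh_instance (fun=> f T) hz) T (exec f hz T) i].
    by rewrite exec_step inE => /step_move[_ -> _ _].
  have [/existsP[i /andP[ri mi]]|_] := boolP gm;
    have [/existsP[i' /and3P[ri' _ mi']]|_] := boolP bz => //=.
  + rewrite eq_sym in mi'; apply/card_gt1P; exists i, i'; rewrite !mv //; split=> //.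
    by apply/eqP => e; rewrite e ltnNge ri' in ri.
  + by apply/card_gt0P; exists i; exact: mv.
  + by rewrite eq_sym in mi'; apply/card_gt0P; exists i'; exact: mv.
- move=> i; have := h2 i.
  have [->|ne] := eqVneq (pos (exec f hz T.+1) i) (pos (exec f hz T) i);
    first by clear; lia.
  have [lt|ge] := ltnP (pos (exec f hz T) i) root; last first.
    by clear; lia.
  have -> : gm by apply/existsP; exists i; rewrite lt.
  have ad : fadj (pos (exec f hz T) i) (pos (exec f hz T.+1) i).
    by move: ne; rewrite exec_step => /step_move[].
  have : pos (exec f hz T.+1) i <= (pos (exec f hz T) i).+2 \/ root <= pos (exec f hz
    T) i.
    by move/fadjP: ad; rewrite /forward /chord; clear; lia.
  by clear -lt; lia.
- have [/existsP[i /and3P[ri _ _]] _|_] := boolP bz.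
    by have := h2 i; rewrite (minn_idPr ri); clear; lia.
  by rewrite addn0 => /h3; clear; lia.
Qed.

End Execution.
End Footprint.

Lemma costly_run (A : algorithm) (n k w : nat) : 1 < k -> 2 < w ->
  6 * (w * w) + 2 * k < n ->
  solves_BHS n k A -> exists I : instance n k, forall T, solved_by A I T ->
    (w - 2) * (w * w) <= T /\ (w - 2) * (w * w) + k <= moves (run A I T).
Proof.
case: n => [//|n]; case: k => [//|k] _ w2 h solves.
have W0 : 0 < w * w by rewrite muln_gt0 !(ltnW (ltnW w2)).
have Kn : k.*2 + 3 <= n by clear -h W0; lia.
have Wl : 6 * (w * w) < n - k.*2.+1 by clear -h; lia.
have [f [z [hz H]]] := costly_instance Kn W0 (erefl _) Wl (ltnW w2) solves.
exists (bh_instance Kn f hz) => T /H le; split.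
  by apply: leq_trans le _; exact: cost_le.
have c0 : 0 < cost Kn A f hz T.
  by apply: leq_trans le; rewrite muln_gt0 subn_gt0 w2.
by rewrite -execE; apply: leq_trans (moves_cost c0); rewrite leq_add2r.
Qed.

(** * The choice of [w] and the real exponent *)

Import Order.TTheory GRing.Theory Num.Theory.
Local Open Scope ring_scope.

Lemma scale_exists (m : nat) : (55 < m)%N ->
  exists w : nat, [/\ (2 < w)%N, (6 * (w * w) < m)%N & (m <= (4 * w) ^ 2)%N].
Proof.
move=> m55.
(* The threshold 55 admits [w = 3], as [6 * 9 = 54]. For the largest admissible [w] the bound
   [m <= 6 (w+1)^2 <= 16 w^2] follows. *)
have ex : exists w, (6 * (w * w) < m)%N by exists 3%N; apply: leq_trans m55.
have bd w : (6 * (w * w) < m)%N -> (w <= m)%N by nia.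
case: (ex_maxnP ex bd) => w wm wmax; exists w.
have w2 : (2 < w)%N by apply: wmax; apply: leq_trans m55.
split=> //; have : (m <= 6 * (w.+1 * w.+1))%N.
  by rewrite leqNgt; apply/negP => /wmax; rewrite ltnn.
nia.
Qed.

Lemma powR_three_halves (R : realType) (x y : R) : 0 <= x -> 0 <= y -> x <= y ^+ 2 ->
  x `^ (3 / 2) <= y ^+ 3.
Proof.
move=> x0 y0 xy.
have -> : y ^+ 3 = (y ^+ 2) `^ (3 / 2).
  rewrite -!powR_mulrn // -powRrM; congr (_ `^ _); by field.
by apply: ge0_ler_powR; rewrite ?nnegrE ?exprn_ge0 //; lra.
Qed.

Theorem theorem6 (R : realType) (Ca Cb : nat) :
  exists (c : R) (N : nat), 0 < c /\
    forall (n k : nat), (1 < k)%N ->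
      0 < n%:R + 2 - 3 * k%:R :> R ->
      N%:R <= n%:R + 2 - 3 * k%:R :> R ->
      forall A : algorithm,
        memory_bounded Ca Cb n k A ->
        solves_BHS n k A ->
        (exists I : instance n k, forall T : nat, solved_by A I T ->
           c * (n%:R + 2 - 3 * k%:R) `^ (3 / 2) <= T%:R) /\
        (exists I : instance n k, forall T : nat, solved_by A I T ->
           c * ((n%:R + 2 - 3 * k%:R) `^ (3 / 2) + 2 * k%:R)
             <= (moves (run A I T))%:R).
Proof.
(* For [w >= 3] one has [(4w)^3 = 64 w^3 <= 200 (w - 2) w^2]; 56 is the threshold of
   [scale_exists]. *)
exists (1 / 200), 56%N; split; first by lra.
move=> n k k1 _ big A _ solves.
have kn : (3 * k + 56 <= n + 2)%N.
  rewrite -(ler_nat R) (natrD _ (3 * k) 56) (natrD _ n 2) natrM.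
  by move: big; lra.
set m := (n + 2 - 3 * k)%N.
have -> : n%:R + 2 - 3 * k%:R = m%:R :> R.
  rewrite /m natrB; last by apply: leq_trans kn; exact: leq_addr.
  by rewrite natrM (natrD _ n 2).
have m55 : (55 < m)%N by rewrite /m; clear -kn; lia.
have [w [w2 wm mw]] := scale_exists m55.
(* As [k >= 2], [n + 2 - 3k] is at most [n - 2k], the number of ring nodes besides the root. *)
have nk : (6 * (w * w) + 2 * k < n)%N by move: wm; rewrite /m; clear -kn k1; lia.
have [I HI] := costly_run k1 w2 nk solves.
have {mw wm}mp : m%:R `^ (3 / 2) <= 200 * ((w - 2) * (w * w))%:R :> R.
  apply: le_trans (powR_three_halves (y := (4 * w)%:R) _ _ _) _ => //.
    by rewrite -natrX ler_nat.
  by rewrite -natrX -natrM ler_nat; nia.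
split; exists I => T /HI[h1 h2].
  by move: h1; rewrite -(ler_nat R); lra.
move: h2; rewrite -(ler_nat R) natrD.
have : 0 <= k%:R :> R by exact: ler0n.
lra.
Qed.
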